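(* Let $\mathfrak C:X'Y'\to Z$ be a quantum multiple access channel. Let $\mathcal U,\mathcal X,\mathcal Y$ be finite sets, for each $x\in\mathcal X$ let $\sigma^{X'}_x$ be a state on $X'$ and for each $y\in\mathcal Y$ let $\sigma_y^{Y'}$ be a state on $Y'$, and let $p(u)p(x|u)p(y|u)$ be a probability distribution on $\mathcal U\times\mathcal X\times\mathcal Y$. Let $$\rho^{UXYZ}:=\sum_{u,x,y}p(u)p(x|u)p(y|u)|u,x,y\rangle\langle u,x,y|^{UXY}\otimes\mathfrak C(\sigma^{X'}_x\otimes\sigma^{Y'}_y).$$ Let $0<\epsilon<1$ and $R_1,R_2$ satisfy $R_1\le I^\epsilon_H(X:YZ|U)_\rho-2-\log\frac1\epsilon$, $R_2\le I^\epsilon_H(Y:XZ|U)_\rho-2-\log\frac1\epsilon$, $R_1+R_2\le I^\epsilon_H(XY:Z|U)_\rho-2-\log\frac1\epsilon$. Then there exists an $(R_1,R_2,2^{135}\epsilon^{1/3})$-quantum MAC code for sending classical information through $\mathfrak C$.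
   Context: Writing $\rho^{XZ}_u,\rho^{YZ}_u,\rho^Z_u,\rho^X_u,\rho^Y_u,\rho^{XY}_u$ for the conditional marginals of $\rho^{UXYZ}$ given $U=u$: $I^\epsilon_H(X:YZ|U)_\rho:=D^\epsilon_H(\rho^{UXYZ}\|\sum_u p(u)|u\rangle\langle u|\otimes\rho^X_u\otimes\rho^{YZ}_u)$, $I^\epsilon_H(Y:XZ|U)_\rho:=D^\epsilon_H(\rho^{UXYZ}\|\sum_u p(u)|u\rangle\langle u|\otimes\rho^Y_u\otimes\rho^{XZ}_u)$, $I^\epsilon_H(XY:Z|U)_\rho:=D^\epsilon_H(\rho^{UXYZ}\|\sum_u p(u)|u\rangle\langle u|\otimes\rho^{XY}_u\otimes\rho^{Z}_u)$, where $D^\epsilon_H(\alpha\|\beta):=\max_\Pi-\log_2\operatorname{Tr}[\Pi\beta]$ over POVM elements $0\le\Pi\le\mathbb 1$ with $\operatorname{Tr}[\Pi\alpha]\ge1-\epsilon$; logs base 2. An $(R_1,R_2,\eta)$-quantum MAC code for classical information through $\mathfrak C$ consists of an encoding of each message $m_1\in[2^{R_1}]$ into a state $\alpha_{m_1}$ on $X'$, of each $m_2\in[2^{R_2}]$ into a state $\beta_{m_2}$ on $Y'$, and a POVM $\{\Lambda_{m_1,m_2}\}$ on $Z$ with average decoding error $2^{-(R_1+R_2)}\sum_{m_1,m_2}\operatorname{Tr}[(\mathbb 1-\Lambda_{m_1,m_2})\mathfrak C(\alpha_{m_1}\otimes\beta_{m_2})]\le\eta$. *)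

(* Defs.v *)
From Stdlib Require Import Reals Lra List Arith ClassicalEpsilon.
Import ListNotations.
Open Scope R_scope.

Record C := mkC { re : R; im : R }.
Definition RtoC (r : R) : C := mkC r 0.
Definition C0 : C := RtoC 0.
Definition C1 : C := RtoC 1.
Definition Cadd (a b : C) : C := mkC (re a + re b) (im a + im b).
Definition Cneg (a : C) : C := mkC (- re a) (- im a).
Definition Cmul (a b : C) : C :=
  mkC (re a * re b - im a * im b) (re a * im b + im a * re b).
Definition Cconj (a : C) : C := mkC (re a) (- im a).

Definition csum (n : nat) (f : nat -> C) : C :=
  fold_right Cadd C0 (map f (seq 0 n)).
Definition rsum (n : nat) (f : nat -> R) : R :=
  fold_right Rplus 0 (map f (seq 0 n)).

(** * Matrices: only entries with indices < the (explicit) dimension matter *)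
Definition Mat := nat -> nat -> C.
Definition Mzero : Mat := fun _ _ => C0.
Definition Mid : Mat := fun i j => if Nat.eqb i j then C1 else C0.
Definition Madd (A B : Mat) : Mat := fun i j => Cadd (A i j) (B i j).
Definition Msub (A B : Mat) : Mat := fun i j => Cadd (A i j) (Cneg (B i j)).
Definition Mscale (c : C) (A : Mat) : Mat := fun i j => Cmul c (A i j).
Definition Rscale (r : R) (A : Mat) : Mat := Mscale (RtoC r) A.
Definition Msum (n : nat) (F : nat -> Mat) : Mat := fun i j => csum n (fun k => F k i j).
Definition Mmul (n : nat) (A B : Mat) : Mat :=
  fun i j => csum n (fun k => Cmul (A i k) (B k j)).
Definition trace (n : nat) (A : Mat) : C := csum n (fun i => A i i).
Definition trRe (n : nat) (A B : Mat) : R := re (trace n (Mmul n A B)).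

(** Kronecker product A (m x m) ⊗ B (n x n); index i of the product is i1*n+i2 *)
Definition kron (m n : nat) (A B : Mat) : Mat :=
  fun i j => Cmul (A (i / n) (j / n))%nat (B (i mod n) (j mod n))%nat.
Definition E (k : nat) : Mat :=
  fun i j => if andb (Nat.eqb i k) (Nat.eqb j k) then C1 else C0.

Definition ptrace_first (a b : nat) (M : Mat) : Mat :=
  fun i j => csum a (fun k => M (k * b + i)%nat (k * b + j)%nat).
Definition ptrace_last (a b : nat) (M : Mat) : Mat :=
  fun i j => csum b (fun k => M (i * b + k)%nat (j * b + k)%nat).
Definition ptrace_mid (a b c : nat) (M : Mat) : Mat :=
  fun i j => csum b (fun k =>
    M ((i / c) * b * c + k * c + i mod c)%nat ((j / c) * b * c + k * c + j mod c)%nat).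
(** Reordering A ⊗ B ⊗ C (dims a,b,c) into B ⊗ A ⊗ C *)
Definition swidx (a b c i : nat) : nat :=
  (((i / c) mod a) * b + (i / c) / a) * c + i mod c.
Definition swap12 (a b c : nat) (M : Mat) : Mat :=
  fun i j => M (swidx a b c i) (swidx a b c j).

Definition Hermitian (n : nat) (A : Mat) : Prop :=
  forall i j, (i < n)%nat -> (j < n)%nat -> A i j = Cconj (A j i).
Definition PSD (n : nat) (A : Mat) : Prop :=
  Hermitian n A /\
  forall v : nat -> C,
    0 <= re (csum n (fun i => Cmul (Cconj (v i)) (csum n (fun j => Cmul (A i j) (v j))))).
Definition density (n : nat) (A : Mat) : Prop := PSD n A /\ trace n A = C1.
Definition povm_elem (n : nat) (P : Mat) : Prop := PSD n P /\ PSD n (Msub Mid P).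

Definition lin_map (din dout : nat) (F : Mat -> Mat) : Prop :=
  (forall A B, (forall i j, (i < din)%nat -> (j < din)%nat -> A i j = B i j) ->
     forall i j, (i < dout)%nat -> (j < dout)%nat -> F A i j = F B i j) /\
  (forall c A B i j, (i < dout)%nat -> (j < dout)%nat ->
     F (Madd (Mscale c A) B) i j = Cadd (Cmul c (F A i j)) (F B i j)).
(** id_k ⊗ F, the ancilla of dimension k being the first factor *)
Definition ampl (din dout : nat) (F : Mat -> Mat) (A : Mat) : Mat :=
  fun i j => F (fun a b => A ((i / dout) * din + a)%nat ((j / dout) * din + b)%nat)
               (i mod dout)%nat (j mod dout)%nat.
Definition is_channel (din dout : nat) (F : Mat -> Mat) : Prop :=
  lin_map din dout F /\
  (forall k A, PSD (k * din) A -> PSD (k * dout) (ampl din dout F A)) /\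
  (forall A, trace dout (F A) = trace din A).

Definition log2 (x : R) : R := ln x / ln 2.
Definition is_DH (n : nat) (alpha beta : Mat) (eps d : R) : Prop :=
  (exists P, povm_elem n P /\ trRe n P alpha >= 1 - eps /\ trRe n P beta > 0 /\
             d = - log2 (trRe n P beta)) /\
  (forall P, povm_elem n P -> trRe n P alpha >= 1 - eps -> trRe n P beta > 0 ->
             - log2 (trRe n P beta) <= d).
Definition DH (n : nat) (alpha beta : Mat) (eps : R) : R :=
  epsilon (inhabits 0) (fun d => is_DH n alpha beta eps d).

Section cq.
Variables (nU nX nY dX dY dZ : nat) (Phi : Mat -> Mat)
          (pu : nat -> R) (px py : nat -> nat -> R) (sX sY : nat -> Mat).

Definition ketbraUXY (u x y : nat) : Mat :=
  kron (nU * nX) nY (kron nU nX (E u) (E x)) (E y).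

Definition rhoUXYZ : Mat :=
  Msum nU (fun u => Msum nX (fun x => Msum nY (fun y =>
    Rscale (pu u * px u x * py u y)
      (kron (nU * nX * nY) dZ (ketbraUXY u x y) (Phi (kron dX dY (sX x) (sY y))))))).

Definition rho_u (u : nat) : Mat :=
  Rscale (/ pu u) (fun i j => rhoUXYZ (u * (nX * nY * dZ) + i)%nat (u * (nX * nY * dZ) + j)%nat).

Definition rhoX_u u := ptrace_last nX (nY * dZ) (rho_u u).
Definition rhoYZ_u u := ptrace_first nX (nY * dZ) (rho_u u).
Definition rhoY_u u := ptrace_last nY dZ (rhoYZ_u u).
Definition rhoXZ_u u := ptrace_mid nX nY dZ (rho_u u).
Definition rhoXY_u u := ptrace_last (nX * nY) dZ (rho_u u).
Definition rhoZ_u u := ptrace_first (nX * nY) dZ (rho_u u).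

Definition refU (T : nat -> Mat) : Mat :=
  Msum nU (fun u => Rscale (pu u) (kron nU (nX * nY * dZ) (E u) (T u))).

Definition ref_X_YZ : Mat := refU (fun u => kron nX (nY * dZ) (rhoX_u u) (rhoYZ_u u)).
Definition ref_Y_XZ : Mat :=
  refU (fun u => swap12 nY nX dZ (kron nY (nX * dZ) (rhoY_u u) (rhoXZ_u u))).
Definition ref_XY_Z : Mat := refU (fun u => kron (nX * nY) dZ (rhoXY_u u) (rhoZ_u u)).

Definition dimUXYZ : nat := (nU * nX * nY * dZ)%nat.
Definition IH_X_YZ (eps : R) : R := DH dimUXYZ rhoUXYZ ref_X_YZ eps.
Definition IH_Y_XZ (eps : R) : R := DH dimUXYZ rhoUXYZ ref_Y_XZ eps.
Definition IH_XY_Z (eps : R) : R := DH dimUXYZ rhoUXYZ ref_XY_Z eps.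
End cq.

(** * Quantum MAC codes with M1 = 2^R1, M2 = 2^R2 messages *)
Definition MAC_code (dX dY dZ : nat) (Phi : Mat -> Mat) (M1 M2 : nat) (eta : R)
  (alpha beta : nat -> Mat) (Lam : nat -> nat -> Mat) : Prop :=
  (forall m1, (m1 < M1)%nat -> density dX (alpha m1)) /\
  (forall m2, (m2 < M2)%nat -> density dY (beta m2)) /\
  (forall m1 m2, (m1 < M1)%nat -> (m2 < M2)%nat -> PSD dZ (Lam m1 m2)) /\
  (forall i j, (i < dZ)%nat -> (j < dZ)%nat ->
     Msum M1 (fun m1 => Msum M2 (fun m2 => Lam m1 m2)) i j = Mid i j) /\
  / (INR M1 * INR M2) *
    rsum M1 (fun m1 => rsum M2 (fun m2 =>
      trRe dZ (Msub Mid (Lam m1 m2)) (Phi (kron dX dY (alpha m1) (beta m2))))) <= eta.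

(* Main.v *)
Require Import Defs.
From Stdlib Require Import Reals.
From mathcomp Require all_boot all_order all_algebra ring lra.
From mathcomp Require boolp classical_sets reals topology normedtype derive Rstruct.
Open Scope R_scope.

(**
Each of the three conditional hypothesis-testing quantities is attained by a test, and restricting
that test to the blocks labelled by [(u, x, y)] gives effects [P1 u x y], [P2 u x y], [P3 u x y]
on the output system. A value [u] is drawn at random and the codewords of the two senders are
drawn independently from [p(x|u)] and [p(y|u)].

To decode, the output system is isometrically embedded in a sum of copies of itself: a common slot
and one slot per message of each sender. An output state [h] is compared with its spread version
[h] in the common slot plus [del *: h] in the slots of the two transmitted messages. If one of
the two messages is guessed wrongly, the projection onto the slots of the guess does not depend on
the true value of that message, so the three tests act on three different vectors and can be
combined into a single effect by a pretty-good measurement [(1 + S)^-1], where [S] sums the odds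
operators [(1 - P) / (P + s)] placed in the corresponding slots. Its rejection probability on the
true pair is [O(del^-2)] times the sum of the three error probabilities, and its acceptance
probability on a false pair is at most twice that of the relevant test. Measuring these effects one
after the other, with a sequential union bound whose cost is linear in the false acceptance
probabilities, yields average error [O(eps / del^2 + eps + del^2)]; take [del = eps^(1/6)].

Complex matrices of size [d] are handled as real matrices of size [d + d], so that only
symmetric real forms occur.
*)

(** * Real quadratic forms and effects *)

Module RealForms.
Import ssreflect ssrfun ssrbool eqtype ssrnat seq choice fintype finfun bigop.
Import order ssralg ssrnum zmodp matrix mxalgebra ring lra.
Set Implicit Arguments.
Unset Strict Implicit.
Unset Printing Implicit Defensive.
Import Order.TTheory GRing.Theory Num.Theory.
Local Open Scope ring_scope.

Section Forms.
Variable R : realFieldType.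
Implicit Types (n : nat) (a c s : R).

Definition dot n (u v : 'cV[R]_n) : R := (u^T *m v) 0 0.

Lemma dotE n (u v : 'cV[R]_n) : dot u v = \sum_i u i 0 * v i 0.
Proof. by rewrite /dot !mxE; apply: eq_bigr => i _; rewrite !mxE. Qed.

Lemma dotC n (u v : 'cV[R]_n) : dot u v = dot v u.
Proof. by rewrite !dotE; apply: eq_bigr => i _; rewrite mulrC. Qed.

Lemma dotDr n (u v w : 'cV[R]_n) : dot u (v + w) = dot u v + dot u w.
Proof. by rewrite /dot mulmxDr mxE. Qed.

Lemma dotZr n a (u v : 'cV[R]_n) : dot u (a *: v) = a * dot u v.
Proof. by rewrite /dot -scalemxAr mxE. Qed.

Lemma dotNr n (u v : 'cV[R]_n) : dot u (- v) = - dot u v.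
Proof. by rewrite -scaleN1r dotZr mulN1r. Qed.

Lemma dot0r n (u : 'cV[R]_n) : dot u 0 = 0.
Proof. by rewrite /dot mulmx0 mxE. Qed.

Lemma dotDl n (u v w : 'cV[R]_n) : dot (u + v) w = dot u w + dot v w.
Proof. by rewrite dotC dotDr ![dot w _]dotC. Qed.

Lemma dotZl n a (u v : 'cV[R]_n) : dot (a *: u) v = a * dot u v.
Proof. by rewrite dotC dotZr dotC. Qed.

Lemma dotNl n (u v : 'cV[R]_n) : dot (- u) v = - dot u v.
Proof. by rewrite dotC dotNr dotC. Qed.

Lemma dot_sumr n (I : finType) (P : pred I) (u : 'cV[R]_n) (v : I -> 'cV[R]_n) :
  dot u (\sum_(i | P i) v i) = \sum_(i | P i) dot u (v i).
Proof. exact: (big_morph _ (dotDr u) (dot0r u)). Qed.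

Lemma dot_mulmxl n m (A : 'M[R]_(n, m)) (u : 'cV_m) (v : 'cV_n) :
  dot (A *m u) v = dot u (A^T *m v).
Proof. by rewrite /dot trmx_mul -mulmxA. Qed.

Lemma dot_ge0 n (u : 'cV[R]_n) : 0 <= dot u u.
Proof. by rewrite dotE sumr_ge0 // => i _; rewrite -expr2 sqr_ge0. Qed.

Lemma dot_eq0 n (u : 'cV[R]_n) : dot u u = 0 -> u = 0.
Proof.
rewrite dotE => /eqP; rewrite psumr_eq0; last by move=> i _; rewrite -expr2 sqr_ge0.
move=> /allP u0; apply/matrixP => i j; rewrite ord1 mxE.
by have := u0 i (mem_index_enum i); rewrite /= -expr2 sqrf_eq0 => /eqP.
Qed.

Definition dotL := (dotDl, dotDr, dotZl, dotZr, dotNl, dotNr, mulmxDl, mulmxDr,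
  mulmxBl, mulmxBr, mulNmx, mulmxN, mul1mx, mulmx1, mul0mx, mulmx0,
  =^~ scalemxAl, =^~ scalemxAr, mul_scalar_mx).

Definition psd n (A : 'M[R]_n) := A^T = A /\ forall v, 0 <= dot v (A *m v).
Definition effect n (A : 'M[R]_n) := psd A /\ psd (1%:M - A).

Lemma dot_sym n (A : 'M[R]_n) u v : A^T = A -> dot (A *m u) v = dot u (A *m v).
Proof. by move=> sA; rewrite dot_mulmxl sA. Qed.

Lemma effect_le1 n (A : 'M[R]_n) v : effect A -> dot v (A *m v) <= dot v v.
Proof.
by case=> _ [_ /(_ v)]; rewrite !dotL subr_ge0.
Qed.

Lemma effectP n (A : 'M[R]_n) :
  A^T = A -> (forall v, 0 <= dot v (A *m v) <= dot v v) -> effect A.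
Proof.
move=> sA H; split; split => //.
- by move=> v; case/andP: (H v).
- by rewrite linearB /= sA trmx1.
- by move=> v; rewrite !dotL subr_ge0; case/andP: (H v).
Qed.

Lemma effect1 n : effect (1%:M : 'M[R]_n).
Proof. by apply: effectP => [|v]; rewrite ?trmx1 // mul1mx dot_ge0 lexx. Qed.

Lemma effectC n (A : 'M[R]_n) : effect A -> effect (1%:M - A).
Proof. by case=> pA pB; split; rewrite // subKr. Qed.

Lemma psdD n (A B : 'M[R]_n) : psd A -> psd B -> psd (A + B).
Proof.
case=> sA pA [sB pB]; split; first by rewrite linearD /= sA sB.
by move=> v; rewrite !dotL addr_ge0.
Qed.

Lemma psd0 n : psd (0 : 'M[R]_n).
Proof. by split => [|v]; rewrite ?trmx0 // mul0mx dot0r. Qed.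

Lemma psdZ n a (A : 'M[R]_n) : 0 <= a -> psd A -> psd (a *: A).
Proof.
move=> a0 [sA pA]; split; first by rewrite linearZ /= sA.
by move=> v; rewrite !dotL mulr_ge0.
Qed.

Lemma psd_sum n (I : finType) (P : pred I) (F : I -> 'M[R]_n) :
  (forall i, P i -> psd (F i)) -> psd (\sum_(i | P i) F i).
Proof. by move=> H; elim/big_ind: _ => //; [exact: psd0 | exact: psdD]. Qed.

Lemma psd_conj n m (A : 'M[R]_n) (K : 'M[R]_(n, m)) : psd A -> psd (K^T *m A *m K).
Proof.
case=> sA pA; split; first by rewrite !trmx_mul trmxK sA mulmxA.
by move=> v; rewrite -!mulmxA -dot_mulmxl.
Qed.

(** Positivity of the form at [c *: u - v]. With a suitable constant [c] it replaces the
    Cauchy-Schwarz inequality and avoids square roots. *)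
Lemma psd_amgm n (A : 'M[R]_n) c u v : psd A ->
  2 * c * dot u (A *m v) <= c ^+ 2 * dot u (A *m u) + dot v (A *m v).
Proof.
move=> [sA /(_ (c *: u - v))]; rewrite !dotL.
have -> : dot v (A *m u) = dot u (A *m v) by rewrite dotC dot_sym.
by move=> H; rewrite -subr_ge0; move: H; congr (_ <= _); ring.
Qed.

(** [A - A^2 = A (1 - A) A + (1 - A) A (1 - A)], a sum of two positive forms. *)
Lemma effect_sqr_le n (A : 'M[R]_n) v :
  effect A -> dot (A *m v) (A *m v) <= dot v (A *m v).
Proof.
case=> [[sA pA] [_ pB]].
have := pB (A *m v); have := pA (v - A *m v); rewrite !dotL.
have e1 : dot (A *m v) (A *m v) = dot v (A *m (A *m v)) by rewrite dot_sym.
have e2 : dot (A *m v) (A *m (A *m v)) = dot v (A *m (A *m (A *m v))) by rewrite dot_sym.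
by rewrite e1 e2 ; lra.
Qed.

(** A vector in the left kernel has form value 0, so the hypothesis makes it vanish. *)
Lemma posdef_unitmx n (A : 'M[R]_n) :
  (forall v, dot v (A *m v) <= 0 -> v = 0) -> A \in unitmx.
Proof.
move=> H; rewrite -row_free_unit -kermx_eq0; apply/eqP/row_matrixP => i.
rewrite row0; set r := row i _.
have rA : r *m A = 0 by rewrite /r -row_mul mulmx_ker row0.
by apply/trmx_inj; rewrite trmx0; apply: H; rewrite /dot trmxK mulmxA rA mul0mx mxE.
Qed.

Lemma dot_pd_unitmx n (A : 'M[R]_n) a : 0 < a ->
  (forall v, a * dot v v <= dot v (A *m v)) -> A \in unitmx.
Proof.
move=> a0 H; apply: posdef_unitmx => v v0; apply: dot_eq0.
have h := le_trans (H v) v0; apply/le_anti; rewrite dot_ge0 andbT.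
by rewrite -(pmulr_rle0 _ a0).
Qed.

Lemma invmx_sym n (A : 'M[R]_n) : A^T = A -> (invmx A)^T = invmx A.
Proof. by move=> sA; rewrite trmx_inv sA. Qed.

End Forms.
End RealForms.

(** * Sequential measurement and the sequential union bound *)

Module Decoder.
Import ssreflect ssrfun ssrbool eqtype ssrnat seq choice fintype finfun bigop.
Import order ssralg ssrnum zmodp matrix mxalgebra ring lra.
Import RealForms.
Set Implicit Arguments.
Unset Strict Implicit.
Unset Printing Implicit Defensive.
Import Order.TTheory GRing.Theory Num.Theory.
Local Open Scope ring_scope.

Section Sequential.
Variables (R : realFieldType) (N : nat) (T : finType) (A : T -> 'M[R]_N).
Hypothesis effA : forall t, effect (A t).
Let symA t : (A t)^T = A t. Proof. by case: (effA t) => [[]]. Qed.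

(* Test the elements of [s] in turn, [A a] being the rejection effect of [a]; [seq_dec s t] is the event that the first acceptance occurs at [t]. *)
Fixpoint seq_dec (s : seq T) (t : T) : 'M[R]_N :=
  if s is a :: r then
    if t == a then 1%:M - A a *m A a else (A a)^T *m seq_dec r t *m A a
  else 0.

Lemma psd_seq_dec s t : psd (seq_dec s t).
Proof.
elim: s => [|a r IH] /=; first exact: psd0.
case: eqP => _; last exact: psd_conj.
split; first by rewrite linearB /= trmx1 trmx_mul !symA.
move=> v; rewrite !dotL -mulmxA -[dot v (A a *m _)]dot_sym //.
by rewrite subr_ge0 (le_trans (effect_sqr_le v (effA a))) // effect_le1.
Qed.

Lemma seq_dec_notin s t : t \notin s -> seq_dec s t = 0.
Proof.
elim: s => //= a r IH; rewrite inE negb_or => /andP [/negPf -> nr].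
by rewrite IH // mulmx0 mul0mx.
Qed.

(** Acceptance at the head of the list uses up [dot v v - dot (A a *m v) (A a *m v)], and the
    remaining tests share at most the norm of the surviving vector [A a *m v]. *)
Lemma sum_seq_dec_le1 s v : uniq s -> dot v ((\sum_t seq_dec s t) *m v) <= dot v v.
Proof.
rewrite mulmx_suml dot_sumr.
elim: s v => [|a r IH] v /=.
  by move=> _; rewrite big1 ?dot_ge0 // => i _; rewrite mul0mx dot0r.
case/andP=> nar ur; rewrite (bigD1 a) //= eqxx.
have -> : \sum_(i | i != a)
   dot v ((if i == a then 1%:M - A a *m A a else (A a)^T *m seq_dec r i *m A a) *m v)
   = \sum_t dot (A a *m v) (seq_dec r t *m (A a *m v)).
  rewrite [RHS](bigD1 a) //= seq_dec_notin // mul0mx dot0r add0r.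
  apply: eq_bigr => i /negPf ->; rewrite [RHS]dot_mulmxl; congr dot.
  by rewrite -!mulmxA.
have := IH (A a *m v) ur; rewrite !dotL -mulmxA -[dot v (A a *m _)]dot_sym //.
by move=> *; lra.
Qed.

(** Here [f] is the undisturbed vector and [b] the one that actually reaches the remaining tests.
    The two correction terms form a potential that vanishes at [b = f]; each wrong test raises it by
    at most 4 times its false acceptance probability on [f], so disturbances add up linearly. *)
Lemma seq_dec_error s t (f b : 'cV[R]_N) : t \in s -> uniq s ->
  dot f f - dot b (seq_dec s t *m b) <=
    2 * dot f (A t *m f) + 4 * \sum_(i <- s | i != t) (dot f f - dot f (A i *m f))
    + 4 * dot f (f - b) - (dot f f - dot b b).
Proof.
elim: s b => //= a r IH b; rewrite inE => tar /andP [nar ur].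
rewrite big_cons; case: (eqVneq t a) tar => [-> _ | nta /= tr].
  have pos : 0 <= \sum_(j <- r | j != a) (dot f f - dot f (A j *m f)).
    by apply: sumr_ge0 => i _; rewrite subr_ge0 effect_le1.
  have h1 := effect_sqr_le (f - b) (effA a).
  have h2 := effect_sqr_le f (effA a).
  have h3 := effect_le1 (f - b) (effA a).
  (* The parallelogram inequality for [A a *m b = A a *m f - A a *m (f - b)]. *)
  have h4 := dot_ge0 (2 *: (A a *m f) - A a *m b).
  rewrite /= !dotL -mulmxA -[dot b (A a *m (A a *m b))]dot_sym //.
  move: h1 h2 h3 h4; rewrite !dotL.
  rewrite [dot b f]dotC [dot (A a *m b) (A a *m f)]dotC.
  by move=> *; lra.
have -> : dot b (((A a)^T *m seq_dec r t *m A a) *m b)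
        = dot (A a *m b) (seq_dec r t *m (A a *m b)).
  by rewrite [RHS]dot_mulmxl -!mulmxA.
have := IH (A a *m b) tr ur.
move: (seq_dec r t) (\sum_(j <- r | _) _) => D S.
set X := dot (A a *m b) (D *m _) => H.
(* The overlap with [f] lost by passing from [b] to [A a *m b] is charged partly to the false
   acceptance on [f] and partly to the norm lost by [b], which [h2] bounds from below by the form of
   [1 - A a]. *)
have h1 := psd_amgm 2 f b (proj1 (effectC (effA a))).
have h2 := effect_sqr_le b (effectC (effA a)).
rewrite /=; apply: (le_trans H); move: h1 h2; rewrite !dotL.
rewrite [dot (A a *m b) b]dotC [dot f b]dotC.
by move=> *; lra.
Qed.

Lemma sequential_decoder (t0 : T) : exists L : T -> 'M[R]_N,
  [/\ forall t, psd (L t), \sum_t L t = 1%:M &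
    forall t f, dot f f - dot f (L t *m f) <=
      2 * dot f (A t *m f) + 4 * \sum_(i | i != t) (dot f f - dot f (A i *m f))].
Proof.
pose s := enum T; pose rest := 1%:M - \sum_t seq_dec s t.
have us : uniq s by exact: enum_uniq.
have prest : psd rest.
  split.
    rewrite linearB /= trmx1 linear_sum /=; congr (_ - _); apply: eq_bigr => t _.
    by case: (psd_seq_dec s t).
  by move=> v; rewrite /rest mulmxBl mul1mx dotDr dotNr subr_ge0 sum_seq_dec_le1.
(* The event that no test accepts is assigned to the arbitrary outcome [t0], which completes the
   measurement. *)
exists (fun t => seq_dec s t + (t == t0)%:R *: rest); split.
- by move=> t; apply: psdD; [exact: psd_seq_dec | apply: psdZ => //; exact: ler0n].
- have e : \sum_t (t == t0)%:R *: rest = rest.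
    by rewrite (bigD1 t0) //= eqxx scale1r big1 ?addr0 // => i /negPf ->; rewrite scale0r.
  by rewrite big_split /= e addrC subrK.
- move=> t f; have := @seq_dec_error s t f f (mem_enum _ _) us.
  have -> : \sum_(i <- s | i != t) (dot f f - dot f (A i *m f)) = \sum_(i | i != t) (dot f f - dot f (A i *m f)).
    by rewrite /s big_enum_cond; apply: eq_bigl => i; rewrite inE.
  move: (\sum_(i | _) _) => S.
  have := proj2 prest f.
  move: (rest) (seq_dec s t) => r D.
  rewrite !dotL => rf; case: eqP => _ /=; rewrite ?mul1r ?mul0r; lra.
Qed.

End Sequential.

(** * Combining several tests into one by a pretty-good measurement *)

Section JointTest.
Variables (R : realFieldType) (k N n : nat).
Variables (K : 'I_k -> 'M[R]_(N, n)) (P : 'I_k -> 'M[R]_n) (s : R).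
Hypothesis s_gt0 : 0 < s.
Hypothesis effP : forall i, effect (P i).
Hypothesis K_norm : forall i y, dot ((K i)^T *m y) ((K i)^T *m y) <= 2 * dot y y.

Let T i : 'M[R]_n := P i + s%:M.
Let symP i : (P i)^T = P i. Proof. by case: (effP i) => [[]]. Qed.
Let symT i : (T i)^T = T i. Proof. by rewrite linearD /= tr_scalar_mx symP. Qed.

Let T_unit i : T i \in unitmx.
Proof.
apply: (dot_pd_unitmx s_gt0) => v; rewrite /T !dotL.
by rewrite lerDr; case: (effP i) => [[_ ->]].
Qed.

(* [odds i] is [(1 - P i) / (P i + s)] in the functional calculus of [P i]. *)
Let odds i : 'M[R]_n := (1 + s) *: invmx (T i) - 1%:M.

Let odds_sym i : (odds i)^T = odds i.
Proof. by rewrite linearB /= linearZ /= invmx_sym // trmx1. Qed.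

Let odds_T i (x : 'cV[R]_n) : odds i *m (T i *m x) = x - P i *m x.
Proof.
rewrite /odds mulmxBl -scalemxAl mulKmx // mul1mx /T mulmxDl mul_scalar_mx scalerDl scale1r.
by rewrite opprD addrACA subrr addr0.
Qed.

Let T_surj i (x : 'cV[R]_n) : exists t, x = T i *m t.
Proof. by exists (invmx (T i) *m x); rewrite mulKVmx. Qed.

(** [mk] is the moment of [P i] of order [k] in the vector [t]; the four inequalities express
    positivity of [P^2 (1 - P)^2], [P (1 - P)], [P (1 - P)^2] and [1 - P]. After a vector is written
    as [T i *m t], which clears the denominator of [odds], operator inequalities become inequalities
    between these numbers. *)
Let moments i (t : 'cV[R]_n) : exists m0 m1 m2 m3 m4 : R,
  [/\ 0 <= m2 - 2 * m3 + m4, 0 <= m1 - m2, 0 <= m1 - 2 * m2 + m3 & 0 <= m0 - m1] /\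
  [/\ dot t t = m0, dot t (P i *m t) = m1, dot (P i *m t) t = m1,
      dot (P i *m t) (P i *m t) = m2 & dot t (P i *m (P i *m t)) = m2] /\
  [/\ dot (P i *m t) (P i *m (P i *m t)) = m3,
      dot (P i *m (P i *m t)) (P i *m t) = m3,
      dot (P i *m (P i *m t)) t = m2,
      dot t (P i *m (P i *m (P i *m t))) = m3
    & dot (P i *m (P i *m t)) (P i *m (P i *m t)) = m4 /\
      dot (P i *m t) (P i *m (P i *m (P i *m t))) = m4].
Proof.
set Q := P i; have sQ : Q^T = Q by exact: symP.
exists (dot t t), (dot t (Q *m t)), (dot (Q *m t) (Q *m t)),
  (dot (Q *m t) (Q *m (Q *m t))), (dot (Q *m (Q *m t)) (Q *m (Q *m t))).
have h0 := effect_le1 t (effP i).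
have h1 := effect_sqr_le t (effP i).
have h2 := dot_ge0 (Q *m t - Q *m (Q *m t)).
have h3 := proj2 (proj1 (effP i)) (t - Q *m t).
have e1 : dot (Q *m t) t = dot t (Q *m t) by exact: dotC.
have e2 : dot t (Q *m (Q *m t)) = dot (Q *m t) (Q *m t) by rewrite dot_sym.
have e3 : dot (Q *m (Q *m t)) (Q *m t) = dot (Q *m t) (Q *m (Q *m t)) by exact: dotC.
have e4 : dot (Q *m (Q *m t)) t = dot (Q *m t) (Q *m t) by rewrite dotC.
have e5 : dot t (Q *m (Q *m (Q *m t))) = dot (Q *m t) (Q *m (Q *m t)) by rewrite dot_sym.
have e6 : dot (Q *m t) (Q *m (Q *m (Q *m t))) = dot (Q *m (Q *m t)) (Q *m (Q *m t)).
  by rewrite [RHS]dot_sym.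
move: h0 h1 h2 h3; rewrite -/Q !dotL e1 e2 e3 => *.
by split; [split; lra|]; do 2 split.
Qed.

(** The scalar form is [p^2 (1 - p) / (p + s) <= 1 - p] on the unit interval, true because
    [p^2 <= p + s]. *)
Let odds_P i (x : 'cV[R]_n) : dot (P i *m x) (odds i *m (P i *m x)) <= dot x x - dot x (P i *m x).
Proof.
have [t ->] := T_surj i x.
have -> : P i *m (T i *m t) = T i *m (P i *m t).
  by rewrite /T !mulmxDl mulmxDr !mul_scalar_mx -scalemxAr.
rewrite odds_T /T.
have [m0 [m1 [m2 [m3 [m4 [[h1 h2 h3 h4] [[e1 e2 e3 e4 e5] [e6 e7 e8 e9 [e10 e11]]]]]]]]] := moments i t.
rewrite !dotL ?(e1, e2, e3, e4, e5, e6, e7, e8, e9, e10, e11).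
have := mulr_ge0 (ltW s_gt0) h2; have := mulr_ge0 (ltW s_gt0) h3.
have := mulr_ge0 (sqr_ge0 s) h4; rewrite expr2; nra.
Qed.

Let odds_ge0 i (y : 'cV[R]_n) : 0 <= dot y (odds i *m y).
Proof.
have [t ->] := T_surj i y; rewrite odds_T /T.
have [m0 [m1 [m2 [m3 [m4 [[h1 h2 h3 h4] [[e1 e2 e3 e4 e5] _]]]]]]] := moments i t.
rewrite !dotL ?(e1, e2, e3, e4, e5); have := mulr_ge0 (ltW s_gt0) h4; nra.
Qed.

Let S : 'M[R]_N := \sum_i K i *m odds i *m (K i)^T.

Let dotS (u v : 'cV[R]_N) : dot u (S *m v) = \sum_i dot ((K i)^T *m u) (odds i *m ((K i)^T *m v)).
Proof.
rewrite mulmx_suml dot_sumr; apply: eq_bigr => i _.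
by rewrite [RHS]dot_mulmxl trmxK -!mulmxA.
Qed.

Let psdS : psd S.
Proof.
split; last by move=> v; rewrite dotS sumr_ge0.
rewrite linear_sum /=; apply: eq_bigr => i _.
by rewrite !trmx_mul odds_sym trmxK mulmxA.
Qed.

Let S1_unit : 1%:M + S \in unitmx.
Proof.
apply: (dot_pd_unitmx (a := 1)) => // v; rewrite !dotL mul1r lerDl.
by case: psdS => _ ->.
Qed.

(** [(1 + S)^-1] damps the directions in which some odds operator is large, which controls false
    acceptance; [s] keeps the odds finite. Rejection of [v] is controlled by a nearby [w] that every
    test, seen through [(K i)^T], tends to accept. *)
Lemma joint_test : exists G : 'M[R]_N,
  [/\ effect G,
    forall i h, dot (K i *m h) (G *m (K i *m h)) <= 2 * dot h (P i *m h) + 2 * s * dot h h &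
    forall v w (x : 'I_k -> 'cV_n), (forall i, (K i)^T *m w = P i *m x i) ->
      dot v v - dot v (G *m v) <=
        dot (v - w) (v - w) + \sum_i (dot (x i) (x i) - dot (x i) (P i *m x i))].
Proof.
have [sS pS] := psdS.
have Gy (v : 'cV[R]_N) : exists y, [/\ invmx (1%:M + S) *m v = y & v = y + S *m y].
  exists (invmx (1%:M + S) *m v); split => //.
  by rewrite -{1}[invmx _ *m v]mul1mx -mulmxDl mulKVmx.
exists (invmx (1%:M + S)); split.
- apply: effectP => [|v].
    by apply: invmx_sym; rewrite linearD /= trmx1 sS.
  have [y [-> ->]] := Gy v; have := pS y; have := dot_ge0 (S *m y); have := dot_ge0 y.
  rewrite !dotL ![dot (S *m y) y]dotC => *; apply/andP; split; lra.
- move=> i h; have [y [-> yv]] := Gy (K i *m h).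
  have [g yg] := T_surj i ((K i)^T *m y).
  have e1 : dot (K i *m h) y = dot h (T i *m g) by rewrite dot_mulmxl yg.
  have e2 : dot (K i *m h) y = dot y y + dot y (S *m y).
    by rewrite {1}yv dotDl [dot (S *m y) y]dotC.
  (* Write [a] for [dot (K i *m h) y]. Keeping only the [i]-th term of [S], and using the norm bound
     [h2], gives [dot g (T i *m g) <= dot y (S *m y) + 2 * dot y y <= 2 * a]; the inequality [h3]
     then yields [a <= 2 * dot h (T i *m h)]. *)
  have h1 : dot (T i *m g) (g - P i *m g) <= dot y (S *m y).
    rewrite dotS (bigD1 i) //= yg odds_T lerDl; apply: sumr_ge0 => j _; exact: odds_ge0.
  have h2 : dot (T i *m g) (T i *m g) <= 2 * dot y y by rewrite -yg; exact: K_norm.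
  have pT : psd (T i).
    split => // v; rewrite /T !dotL addr_ge0 //; first by case: (effP i) => [[_ ->]].
    by rewrite mulr_ge0 ?dot_ge0 // ltW.
  have h3 := psd_amgm 2 h g pT.
  have h4 := mulr_ge0 (ltW s_gt0) (dot_ge0 g).
  have h5 := mulr_ge0 (ltW s_gt0) h4.
  move: h1 h2 h3 h4 h5; rewrite e1 in e2 *; rewrite e2; move: e2; rewrite /T.
  have [m0 [m1 [m2 [m3 [m4 [[k1 k2 k3 k4] [[d1 d2 d3 d4 d5] _]]]]]]] := moments i g.
  rewrite !dotL ?(d1, d2, d3, d4, d5).
  move: (dot y y) (dot y (S *m y)) (dot h h) (dot h (P i *m h)) (dot h (P i *m g)) (dot h g).
  by move=> *; lra.
- move=> v w x wx; have [y [-> ->]] := Gy v.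
  (* The rejection probability of [v] is the minimum over [w] of
     [dot (v - w) (v - w) + dot w (S *m w)], attained at [y]; the gap at [w] is the form of [1 + S]
     at [y - w]. *)
  have h1 : dot w (S *m w) <= \sum_i (dot (x i) (x i) - dot (x i) (P i *m x i)).
    by rewrite dotS ler_sum // => i _; rewrite wx.
  have h2 := pS (y - w); have h3 := dot_ge0 (y - w).
  apply: (le_trans _ (lerD (lexx _) h1)); move: h2 h3.
  rewrite !dotL ?[dot (S *m y) _]dotC ?[dot w (S *m y)]dotC ?[dot w y]dotC !dot_sym //.
  by move=> *; lra.
Qed.

End JointTest.
End Decoder.

(** * Rank-one decomposition and positivity of traces *)

Module MacDecoder.
Import ssreflect ssrfun ssrbool eqtype ssrnat seq choice fintype finfun bigop.
Import order ssralg ssrnum zmodp matrix mxalgebra ring lra.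
Import RealForms Decoder.
Set Implicit Arguments.
Unset Strict Implicit.
Unset Printing Implicit Defensive.
Import Order.TTheory GRing.Theory Num.Theory.
Local Open Scope ring_scope.

Section RankOne.
Variable R : realFieldType.

Lemma dot_delta n (A : 'M[R]_n) i j :
  dot (delta_mx i 0) (A *m delta_mx j 0) = A i j.
Proof.
by rewrite /dot trmx_delta mulmxA -rowE -colE !mxE.
Qed.

Lemma psd_diag0 n (A : 'M[R]_n) i : psd A -> A i i = 0 -> forall j, A i j = 0.
Proof.
move=> pA Aii j; apply/eqP/negP => /negP Aij.
(* This constant turns the bound into [2 * (A j j + 1) <= A j j], against [0 <= A j j]. *)
have := psd_amgm ((A j j + 1) / A i j) (delta_mx i 0) (delta_mx j 0) pA.
rewrite !dot_delta Aii mulr0 add0r -mulrA divfK //.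
by have := proj2 pA (delta_mx j 0); rewrite dot_delta; lra.
Qed.

(* Induction along the rank-one terms of the pivoted (LDL) decomposition. *)
Lemma psd_rank1_ind n (Q : 'M[R]_n -> Prop) :
  Q 0 -> (forall d (v : 'cV_n) B, 0 <= d -> Q B -> Q (d *: (v *m v^T) + B)) ->
  forall A, psd A -> Q A.
Proof.
move=> Q0 QS A pA.
(* Induction on the number [k] of trailing rows that may be nonzero; each step clears the first of
   them, the pivot row [l]. *)
suff H k : forall B : 'M[R]_n, psd B ->
    (forall i j : 'I_n, (i + k < n)%N -> B i j = 0) -> Q B.
  by apply: (H n A pA) => i j; rewrite ltnNge leq_addl.
elim: k => [|k IH] B pB B0.
  suff -> : B = 0 by [].
  by apply/matrixP => i j; rewrite mxE B0 ?addn0.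
case: (ltnP k n) => kn; last first.
  apply: IH => // i j; rewrite ltnNge.
  by rewrite (leq_trans kn) ?leq_addl.
have nk : (n - k.+1 < n)%N by rewrite ltn_subrL /= (leq_ltn_trans (leq0n k) kn).
pose l := Ordinal nk.
have lP (i : 'I_n) : (i + k < n)%N -> (i + k.+1 < n)%N \/ i = l.
  move=> ikn; rewrite addnS; case: (ltnP (i + k).+1 n) => h; [by left | right].
  apply/val_inj => /=; apply/eqP; rewrite -(eqn_add2r k.+1) subnK // addnS eqn_leq.
  by rewrite ikn h.
have [sB _] := pB; have Bl0 : 0 <= B l l.
  by have := proj2 pB (delta_mx l 0); rewrite dot_delta.
case: (eqVneq (B l l) 0) => [Bll | Bll].
  by apply: IH => // i j /lP [/B0 -> // | ->]; apply: psd_diag0.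
set a := B l l in Bl0 Bll; pose v := col l B.
have vT : v^T = row l B by rewrite /v -{2}sB tr_col.
have pC : psd (B - a^-1 *: (v *m v^T)).
  split; first by rewrite linearB linearZ /= trmx_mul trmxK sB.
  (* The form of the Schur complement at [x] is that of [B] at [x] shifted along the pivot
     direction, the shift being the one that minimises [B]. *)
  move=> x; have [_ /(_ (x - (a^-1 * dot v x) *: delta_mx l 0))] := pB.
  have e1 : B *m delta_mx l 0 = v by rewrite -colE.
  have e2 : dot (delta_mx l 0) (B *m x) = dot v x by rewrite -dot_sym // e1.
  have e3 : dot (delta_mx l 0) v = a by rewrite -e1 dot_delta.
  have e4 : dot x (v *m v^T *m x) = dot v x ^+ 2.
    by rewrite -mulmxA [v^T *m x]mx11_scalar mul_mx_scalar dotZr -/(dot v x) [dot x v]dotC expr2.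
  rewrite !dotL e1 e2 e3 e4 [dot x v]dotC.
  congr (_ <= _); field; exact: Bll.
have -> : B = a^-1 *: (v *m v^T) + (B - a^-1 *: (v *m v^T)) by rewrite addrC subrK.
apply: QS; first by rewrite invr_ge0.
move: pC; set C := B - _ => pC.
have CE i j : C i j = B i j - a^-1 * (B i l * B l j).
  by rewrite /C vT !mxE big_ord1 !mxE.
apply: IH => // i j /lP [h | ->].
  by rewrite CE (B0 i j h) (B0 i l h) mul0r mulr0 subrr.
by rewrite CE mulrA mulVf // mul1r subrr.
Qed.

Lemma mxtrace_rank1 n (M : 'M[R]_n) v : \tr (M *m (v *m v^T)) = dot v (M *m v).
Proof. by rewrite mulmxA mxtrace_mulC mulmxA trace_mx11 /dot mulmxA. Qed.

(** On a rank-one term the trace is a value of the form [M]. This carries bounds proved for vectors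
    over to mixed states. *)
Lemma mxtrace_psd_ge0 n (M A : 'M[R]_n) :
  (forall v, 0 <= dot v (M *m v)) -> psd A -> 0 <= \tr (M *m A).
Proof.
move=> pM; move: A; apply: psd_rank1_ind => [|d v B d0 IH]; first by rewrite mulmx0 mxtrace0.
rewrite mulmxDr -scalemxAr mxtraceD mxtraceZ mxtrace_rank1.
by rewrite addr_ge0 // mulr_ge0.
Qed.

End RankOne.

(** * Orthogonal copies of the output space *)

Section Slots.
Variable R : realFieldType.

(** [J i] is the inclusion of the [i]-th summand in a direct sum of [#|I|] copies. *)
Lemma orthogonal_slots (I : finType) n : exists N (J : I -> 'M[R]_(N, n)),
  forall i j, (J i)^T *m J j = (i == j)%:R%:M.
Proof.
exists (\sum_(k < #|I|) n)%N.
pose B (i : I) (k : 'I_#|I|) : 'M[R]_((fun=> n) k, n) := (k == enum_rank i)%:R%:M.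
exists (fun i => \mxcol_k B i k) => i j.
rewrite tr_mxcol mul_mxrow_mxcol (bigD1 (enum_rank i)) //= /B eqxx trmx1 mul1mx.
rewrite big1 => [|k /negPf ->]; last by rewrite tr_scalar_mx mul_scalar_mx scale0r.
by rewrite addr0 (inj_eq enum_rank_inj).
Qed.

Lemma sum_pair_neq (T1 T2 : finType) (a : T1) (b : T2) (f : T1 * T2 -> R) :
  \sum_(i | i != (a, b)) f i =
    \sum_(x | x != a) f (x, b) + \sum_(y | y != b) f (a, y)
    + \sum_(x | x != a) \sum_(y | y != b) f (x, y).
Proof.
have tot : \sum_i f i = \sum_x \sum_y f (x, y).
  by rewrite pair_big /=; apply: eq_bigr => [[x y]].
apply: (@addrI _ (f (a, b))); rewrite -(bigD1 (a, b) (P := predT)) //= tot.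
rewrite (bigD1 a) //= (bigD1 b) //=.
have -> : \sum_(i | i != a) \sum_y f (i, y) =
    \sum_(i | i != a) (f (i, b) + \sum_(y | y != b) f (i, y)).
  by apply: eq_bigr => i _; rewrite (bigD1 b).
by rewrite big_split /=; lra.
Qed.

End Slots.

(** * The test for one pair of messages *)

Section Mac.
Variables (R : realFieldType) (N n : nat) (T1 T2 : finType).
Variables (J0 : 'M[R]_(N, n)) (Ja : T1 -> 'M[R]_(N, n)) (Jb : T2 -> 'M[R]_(N, n)).
Hypothesis J00 : forall u, J0^T *m (J0 *m u) = u :> 'cV_n.
Hypothesis Jaa : forall x u, (Ja x)^T *m (Ja x *m u) = u :> 'cV_n.
Hypothesis Jbb : forall y u, (Jb y)^T *m (Jb y *m u) = u :> 'cV_n.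
Hypothesis Jaa' : forall x x' u, x' != x -> (Ja x)^T *m (Ja x' *m u) = 0 :> 'cV_n.
Hypothesis Jbb' : forall y y' u, y' != y -> (Jb y)^T *m (Jb y' *m u) = 0 :> 'cV_n.
Hypothesis J0a : forall x u, J0^T *m (Ja x *m u) = 0 :> 'cV_n.
Hypothesis Ja0 : forall x u, (Ja x)^T *m (J0 *m u) = 0 :> 'cV_n.
Hypothesis J0b : forall y u, J0^T *m (Jb y *m u) = 0 :> 'cV_n.
Hypothesis Jb0 : forall y u, (Jb y)^T *m (J0 *m u) = 0 :> 'cV_n.
Hypothesis Jab : forall x y u, (Ja x)^T *m (Jb y *m u) = 0 :> 'cV_n.
Hypothesis Jba : forall x y u, (Jb y)^T *m (Ja x *m u) = 0 :> 'cV_n.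
Let JE := (J00, Jaa, Jbb, J0a, Ja0, J0b, Jb0, Jab, Jba).

Variables (P1 P2 P3 : T1 -> T2 -> 'M[R]_n) (s del : R).
Hypothesis eff1 : forall x y, effect (P1 x y).
Hypothesis eff2 : forall x y, effect (P2 x y).
Hypothesis eff3 : forall x y, effect (P3 x y).
Hypothesis s_gt0 : 0 < s.
Hypothesis del_gt0 : 0 < del.
Hypothesis del_le1 : del <= 1.

(* A state is spread over a common slot and, with small amplitude, over the slots labelled by the two messages: a test for one wrong message then sees a vector that does not depend on the true value of that message. *)
Definition spread x y (h : 'cV[R]_n) : 'cV[R]_N :=
  J0 *m h + del *: (Ja x *m h) + del *: (Jb y *m h).

Lemma mac_test x y : exists E : 'M[R]_N,
  [/\ effect E,
    forall h, dot (spread x y h) (spread x y h) - dot (spread x y h) (E *m spread x y h) <=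
      12 / del ^+ 2 * ((dot h h - dot h (P1 x y *m h)) + (dot h h - dot h (P2 x y *m h))
        + (dot h h - dot h (P3 x y *m h))),
    forall x' h, x' != x -> dot (spread x' y h) (E *m spread x' y h) <=
      2 * dot h (P1 x y *m h) + 2 * s * dot h h,
    forall y' h, y' != y -> dot (spread x y' h) (E *m spread x y' h) <=
      2 * dot h (P2 x y *m h) + 2 * s * dot h h &
    forall x' y' h, x' != x -> y' != y -> dot (spread x' y' h) (E *m spread x' y' h) <=
      2 * dot h (P3 x y *m h) + 2 * s * dot h h].
Proof.
(* The three cases are a wrong first message, a wrong second message, and both wrong: [K i *m h] is
   what the slots of the guess [(x, y)] retain of the spread state. *)
pose K (i : 'I_3) := if val i == 0%N then J0 + del *: Jb y
  else if val i == 1%N then J0 + del *: Ja x else J0.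
pose P (i : 'I_3) := if val i == 0%N then P1 x y
  else if val i == 1%N then P2 x y else P3 x y.
have effP i : effect (P i) by rewrite /P; case: ifP => // _; case: ifP.
have tK (A B : 'M[R]_(N, n)) : (A + del *: B)^T = A^T + del *: B^T.
  by rewrite linearD linearZ.
have d1 : del ^+ 2 <= 1 by rewrite exprn_ile1 // ltW.
(* Bessel's inequality for three mutually orthogonal slots; it gives the norm bound asked by
   [joint_test] and the contractivity of [F]. *)
have norm3 (v : 'cV[R]_N) :
    dot (J0^T *m v) (J0^T *m v) + dot ((Ja x)^T *m v) ((Ja x)^T *m v)
    + dot ((Jb y)^T *m v) ((Jb y)^T *m v) <= dot v v.
  have := dot_ge0 (v - J0 *m (J0^T *m v) - Ja x *m ((Ja x)^T *m v) - Jb y *m ((Jb y)^T *m v)).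
  rewrite !dotL !(dot_mulmxl J0, dot_mulmxl (Ja x), dot_mulmxl (Jb y)) !JE !dot0r.
  rewrite ![dot v (_ *m (_^T *m v))]dotC !(dot_mulmxl J0, dot_mulmxl (Ja x), dot_mulmxl (Jb y)).
  by move=> *; lra.
have two (u v : 'cV[R]_n) : dot (u + del *: v) (u + del *: v) <= 2 * (dot u u + dot v v).
  have h1 := dot_ge0 (u - del *: v).
  have h2 : 0 <= (1 - del ^+ 2) * dot v v by rewrite mulr_ge0 ?dot_ge0 ?subr_ge0.
  by move: h1 h2; rewrite !dotL [dot v u]dotC => *; lra.
have Knorm i v : dot ((K i)^T *m v) ((K i)^T *m v) <= 2 * dot v v.
  have h1 := norm3 v; have h2 := dot_ge0 (J0^T *m v); have h3 := dot_ge0 ((Ja x)^T *m v).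
  have h4 := dot_ge0 ((Jb y)^T *m v).
  rewrite /K; case: ifP => _; [|case: ifP => _]; last by lra.
  - rewrite tK mulmxDl -scalemxAl.
    by apply: (le_trans (two _ _)); lra.
  - rewrite tK mulmxDl -scalemxAl.
    by apply: (le_trans (two _ _)); lra.
have [G [effG sound comp]] := joint_test s_gt0 effP Knorm.
(* The projection onto the common slot and the two slots of the guess. Sandwiching [G] by it erases
   the slots of all other messages. *)
pose F := J0 *m J0^T + Ja x *m (Ja x)^T + Jb y *m (Jb y)^T.
have sF : F^T = F by rewrite !linearD /= !trmx_mul !trmxK.
have FE u v : dot u (F *m G *m F *m v) = dot (F *m u) (G *m (F *m v)).
  by rewrite dot_sym // !mulmxA.
have FX (v : 'cV[R]_N) : F *m v =
    J0 *m (J0^T *m v) + Ja x *m ((Ja x)^T *m v) + Jb y *m ((Jb y)^T *m v).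
  by rewrite /F !mulmxDl !mulmxA.
have FF (v : 'cV[R]_N) : dot (F *m v) (F *m v) <= dot v v.
  apply: (le_trans _ (norm3 v)); rewrite FX.
  rewrite !dotL !(dot_mulmxl J0, dot_mulmxl (Ja x), dot_mulmxl (Jb y)) !JE !dot0r.
  by lra.
exists (F *m G *m F); split.
- apply: effectP => [|v].
    by rewrite !trmx_mul sF (proj1 (proj1 effG)) mulmxA.
  rewrite FE (proj2 (proj1 effG)) /=.
  exact: le_trans (effect_le1 _ effG) (FF v).
- move=> h; rewrite FE.
  have -> : F *m spread x y h = spread x y h.
    rewrite FX /spread !(mulmxDr, mulmxDl) -!scalemxAr !JE.
    by rewrite !(scaler0, addr0, add0r, mulmx0).
  (* The correction [e] must make [(K i)^T *m (spread x y h - e) = P i *m xs i] hold for all three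
     [i]. With [xs] equal to [c *: h], [c *: h] and [h], the third equation fixes the component [q3]
     in the common slot and the other two fix [eb] and [ea]; solving for these divides by [del],
     whence the factor [del^-2]. *)
  pose c := 1 + del ^+ 2; pose r := del^-1.
  have [q1 q1E] : exists q, q = h - P1 x y *m h by exists (h - P1 x y *m h).
  have [q2 q2E] : exists q, q = h - P2 x y *m h by exists (h - P2 x y *m h).
  have [q3 q3E] : exists q, q = h - P3 x y *m h by exists (h - P3 x y *m h).
  have [ea eaE] : exists q, q = r *: (c *: q2 - q3) by exists (r *: (c *: q2 - q3)).
  have [eb ebE] : exists q, q = r *: (c *: q1 - q3) by exists (r *: (c *: q1 - q3)).
  pose e := J0 *m q3 + Ja x *m ea + Jb y *m eb.
  pose xs (i : 'I_3) := if val i == 0%N then c *: h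
    else if val i == 1%N then c *: h else h.
  have dr : del * r = 1 by rewrite /r divff // gt_eqF.
  have hK i : (K i)^T *m (spread x y h - e) = P i *m xs i.
    rewrite /K /P /xs; case: ifP => _; [|case: ifP => _].
    + rewrite tK mulmxDl -scalemxAl /spread /e !(mulmxBr, mulmxDr) -!scalemxAr !JE.
      rewrite ebE q1E q3E /c /r; move: (P1 x y *m h) (P3 x y *m h) => p p3.
      apply/matrixP => i' j; rewrite !mxE; field; exact: lt0r_neq0.
    + rewrite tK mulmxDl -scalemxAl /spread /e !(mulmxBr, mulmxDr) -!scalemxAr !JE.
      rewrite eaE q2E q3E /c /r; move: (P2 x y *m h) (P3 x y *m h) => p p3.
      apply/matrixP => i' j; rewrite !mxE; field; exact: lt0r_neq0.
    + rewrite /spread /e !(mulmxBr, mulmxDr) -!scalemxAr !JE !(scaler0, addr0).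
      by rewrite q3E subKr.
  apply: (le_trans (comp _ _ _ hK)); rewrite subKr.
  have -> : dot e e = dot q3 q3 + dot ea ea + dot eb eb.
    rewrite /e !dotL !(dot_mulmxl J0, dot_mulmxl (Ja x), dot_mulmxl (Jb y)) !JE !dot0r.
    by lra.
  have b1 (Q : 'M[R]_n) : effect Q ->
      dot (h - Q *m h) (h - Q *m h) <= dot h h - dot h (Q *m h).
    by move=> /effectC/(effect_sqr_le h); rewrite !dotL.
  have p1 := b1 _ (eff1 x y); have p2 := b1 _ (eff2 x y); have p3 := b1 _ (eff3 x y).
  rewrite !big_ord_recl big_ord0 /xs /P /= addr0 -!scalemxAr !dotZr !dotZl.
  rewrite eaE ebE !dotZl !dotZr.
  have b2 (u v : 'cV[R]_n) : dot (c *: u - v) (c *: u - v) <= 8 * dot u u + 2 * dot v v.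
    have h1 := dot_ge0 (c *: u + v).
    have c2 : c ^+ 2 <= 4 by rewrite /c expr2; nra.
    have h2 : 0 <= (4 - c ^+ 2) * dot u u by rewrite mulr_ge0 ?dot_ge0 ?subr_ge0.
    by move: h1 h2; rewrite !dotL [dot v u]dotC expr2 => *; lra.
  have b3 := b2 q1 q3; have b4 := b2 q2 q3.
  have c2 : c * c <= 4 by rewrite /c; nra.
  have r1 : 1 <= r * r by rewrite /r -invfM invf_ge1 -expr2 // exprn_gt0.
  (* Each one-message test contributes [8 * (r * r)] through [e] and at most 4 through [c * c];
     since [1 <= r * r], the coefficient 12 absorbs both, and the smaller share of the third
     test. *)
  have -> : 12 / del ^+ 2 = 12 * (r * r) by rewrite /r expr2 invfM.
  have g1 := le_trans (dot_ge0 _) p1; have g2 := le_trans (dot_ge0 _) p2.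
  have g3 := le_trans (dot_ge0 _) p3.
  have r0 := le_trans ler01 r1.
  have k1 := ler_wpM2l r0 b3; have k2 := ler_wpM2l r0 b4.
  rewrite -q1E in p1; rewrite -q2E in p2; rewrite -q3E in p3.
  move: k1 k2 p1 p2 p3 g1 g2 g3.
  move: (dot (c *: q1 - q3) _) (dot (c *: q2 - q3) _) (dot q1 q1) (dot q2 q2) (dot q3 q3).
  move: (dot h h) (dot h (P1 x y *m h)) (dot h (P2 x y *m h)) (dot h (P3 x y *m h)).
  move=> hh h1 h2 h3 D1 D2 u1 u2 u3 k1 k2 p1 p2 p3 g1 g2 g3.
  have m1 := ler_wpM2l r0 p1; have m2 := ler_wpM2l r0 p2; have m3 := ler_wpM2l r0 p3.
  have n1 := ler_wpM2r g1 r1; have n2 := ler_wpM2r g2 r1; have n3 := ler_wpM2r g3 r1.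
  have l1 := ler_wpM2r g1 c2; have l2 := ler_wpM2r g2 c2.
  by move: k1 k2 m1 m2 m3 n1 n2 n3 l1 l2 p3 g3 => *; lra.
- move=> x' h x'x; have := sound ord0 h; rewrite FE /K /P /=.
  have -> : F *m spread x' y h = (J0 + del *: Jb y) *m h.
    rewrite FX /spread !(mulmxDr, mulmxDl) -!scalemxAr !JE Jaa' //.
    by rewrite !(scaler0, addr0, add0r, mulmx0) -scalemxAl.
  by [].
- move=> y' h y'y; have := sound (lift ord0 ord0) h; rewrite FE /K /P /=.
  have -> : F *m spread x y' h = (J0 + del *: Ja x) *m h.
    rewrite FX /spread !(mulmxDr, mulmxDl) -!scalemxAr !JE Jbb' //.
    by rewrite !(scaler0, addr0, add0r, mulmx0) -scalemxAl.
  by [].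
- move=> x' y' h x'x y'y; have := sound ord_max h; rewrite FE /K /P /=.
  have -> : F *m spread x' y' h = J0 *m h.
    rewrite FX /spread !(mulmxDr, mulmxDl) -!scalemxAr !JE Jbb' // Jaa' //.
    by rewrite !(scaler0, addr0, add0r, mulmx0).
  by [].
Qed.
End Mac.
End MacDecoder.

(** * The decoder of a fixed code *)

Module RandomCode.
Import ssreflect ssrfun ssrbool eqtype ssrnat seq choice fintype finfun bigop.
Import order ssralg ssrnum zmodp matrix mxalgebra ring lra.
Import RealForms Decoder MacDecoder.
Set Implicit Arguments.
Unset Strict Implicit.
Unset Printing Implicit Defensive.
Import Order.TTheory GRing.Theory Num.Theory.
Local Open Scope ring_scope.

Section MacDecoding.
Variables (R : realFieldType) (n : nat) (T1 T2 : finType).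
Variables (P1 P2 P3 : T1 -> T2 -> 'M[R]_n) (s del : R).
Hypothesis eff1 : forall x y, effect (P1 x y).
Hypothesis eff2 : forall x y, effect (P2 x y).
Hypothesis eff3 : forall x y, effect (P3 x y).
Hypothesis s_gt0 : 0 < s.
Hypothesis del_gt0 : 0 < del.
Hypothesis del_le1 : del <= 1.

(** The pair tests are measured in sequence and pulled back along the common slot. The constants are
    [48 = 2 * 2 * 12] and [16 = 2 * 4 * 2]: the factor lost in [near], that of the sequential bound,
    and that of [mac_test]. *)
Lemma mac_decoder (t1 : T1) (t2 : T2) : exists L : T1 -> T2 -> 'M[R]_n,
  [/\ forall x y, psd (L x y), \sum_x \sum_y L x y = 1%:M &
   forall x y h, dot h h - dot h (L x y *m h) <=
    48 / del ^+ 2 * ((dot h h - dot h (P1 x y *m h)) + (dot h h - dot h (P2 x y *m h))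
        + (dot h h - dot h (P3 x y *m h)))
    + 16 * (\sum_(x' | x' != x) (dot h (P1 x' y *m h) + s * dot h h)
      + \sum_(y' | y' != y) (dot h (P2 x y' *m h) + s * dot h h)
      + \sum_(x' | x' != x) \sum_(y' | y' != y) (dot h (P3 x' y' *m h) + s * dot h h))
    + 4 * del ^+ 2 * dot h h].
Proof.
have [N [J JJ]] := @orthogonal_slots R (option (T1 + T2)) n.
pose J0 := J None; pose Ja x := J (Some (inl x)); pose Jb y := J (Some (inr y)).
have Je i (u : 'cV_n) : (J i)^T *m (J i *m u) = u by rewrite mulmxA JJ eqxx mul1mx.
have Jn i j (u : 'cV_n) : j != i -> (J i)^T *m (J j *m u) = 0.
  by rewrite mulmxA JJ eq_sym => /negPf ->; rewrite mul_scalar_mx scale0r.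
have := @mac_test R N n T1 T2 J0 Ja Jb (Je _) (fun x => Je _) (fun x => Je _).
move=> /(_ (fun x x' u d => Jn (Some (inl x)) (Some (inl x')) u d)).
move=> /(_ (fun x x' u d => Jn (Some (inr x)) (Some (inr x')) u d)).
move=> /(_ (fun x u => Jn None (Some (inl x)) u isT)).
move=> /(_ (fun x u => Jn (Some (inl x)) None u isT)).
move=> /(_ (fun x u => Jn None (Some (inr x)) u isT)).
move=> /(_ (fun x u => Jn (Some (inr x)) None u isT)).
move=> /(_ (fun x y u => Jn (Some (inl x)) (Some (inr y)) u isT)).
move=> /(_ (fun x y u => Jn (Some (inr y)) (Some (inl x)) u isT)).
move=> /(_ P1 P2 P3 s del eff1 eff2 eff3 s_gt0 del_gt0 del_le1) mt.
have [E HE] := fin_all_exists (fun t : T1 * T2 => mt t.1 t.2).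
have effA t : effect (1%:M - E t) by apply: effectC; case: (HE t).
have [L [pL sumL errL]] := sequential_decoder effA (t1, t2).
exists (fun x y => J0^T *m L (x, y) *m J0); split.
- by move=> x y; apply: psd_conj.
- rewrite pair_big /=.
  transitivity (J0^T *m (\sum_t L t) *m J0); last by rewrite sumL mulmx1 JJ eqxx.
  by rewrite mulmx_sumr mulmx_suml; apply: eq_bigr => [[x y]].
- move=> x y h.
  have effL : effect (1%:M - L (x, y)).
    apply: effectC; split=> //; rewrite -sumL (bigD1 (x, y)) //= addrC addrK.
    by apply: psd_sum.
  have [v vE] : exists v, v = spread J0 Ja Jb del x y h by exists (spread J0 Ja Jb del x y h).
  have -> : dot h (J0^T *m L (x, y) *m J0 *m h) = dot (J0 *m h) (L (x, y) *m (J0 *m h)).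
    by rewrite [RHS]dot_mulmxl !mulmxA.
  have -> : dot h h = dot (J0 *m h) (J0 *m h) by rewrite dot_mulmxl Je.
  (* The decoder receives [J0 *m h], whereas the tests are designed for its spread version [v]. The
     rejection effect at [J0 *m h] is at most twice its value at [v] plus twice the squared
     distance, which is [2 * del ^+ 2] times the squared norm. *)
  have near : dot (J0 *m h) (J0 *m h) - dot (J0 *m h) (L (x, y) *m (J0 *m h)) <=
      2 * (dot v v - dot v (L (x, y) *m v)) + 4 * del ^+ 2 * dot (J0 *m h) (J0 *m h).
    have k1 := effect_le1 (v - J0 *m h) effL.
    have k2 := proj2 (proj1 effL) (2 *: v - J0 *m h).
    have k3 : dot (v - J0 *m h) (v - J0 *m h) = 2 * del ^+ 2 * dot (J0 *m h) (J0 *m h).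
      have -> : v - J0 *m h = del *: (Ja x *m h + Jb y *m h).
        by rewrite vE /spread scalerDr -!addrA addrC -!addrA addNr addr0.
      rewrite dotZl dotZr !dotDl !dotDr !dot_mulmxl !Je !Jn //.
      by rewrite !dot0r; ring.
    move: k1 k2; rewrite k3; move: (v) (J0 *m h) (proj1 (proj1 effL)) => w u.
    rewrite linearB /= trmx1 => /addrI/oppr_inj sL; rewrite !dotL.
    have -> : dot w (L (x, y) *m u) = dot u (L (x, y) *m w) by rewrite -dot_sym // dotC.
    have -> : dot w u = dot u w by rewrite dotC.
    have := dot_ge0 (2 *: w - u); rewrite !dotL.
    by move=> *; lra.
  apply: (le_trans near); rewrite dot_mulmxl Je lerD2r.
  have := errL (x, y) v.
  have -> : \sum_(i | i != (x, y)) (dot v v - dot v ((1%:M - E i) *m v)) =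
            \sum_(i | i != (x, y)) dot v (E i *m v).
    by apply: eq_bigr => i _; rewrite !dotL opprB addrC subrK.
  rewrite sum_pair_neq !dotL.
  have [_ /(_ h) c1 _ _ _] := HE (x, y); rewrite /= -vE in c1.
  have b1 : \sum_(x' | x' != x) dot v (E (x', y) *m v) <=
      2 * \sum_(x' | x' != x) (dot h (P1 x' y *m h) + s * dot h h).
    rewrite mulr_sumr ler_sum // => x' x'x; rewrite mulrDr mulrA.
    by have [_ _ H _ _] := HE (x', y); rewrite vE; apply: H; rewrite eq_sym.
  have b2 : \sum_(y' | y' != y) dot v (E (x, y') *m v) <=
      2 * \sum_(y' | y' != y) (dot h (P2 x y' *m h) + s * dot h h).
    rewrite mulr_sumr ler_sum // => y' y'y; rewrite mulrDr mulrA.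
    by have [_ _ _ H _] := HE (x, y'); rewrite vE; apply: H; rewrite eq_sym.
  have b3 : \sum_(x' | x' != x) \sum_(y' | y' != y) dot v (E (x', y') *m v) <=
      2 * \sum_(x' | x' != x) \sum_(y' | y' != y) (dot h (P3 x' y' *m h) + s * dot h h).
    rewrite mulr_sumr ler_sum // => x' x'x; rewrite mulr_sumr ler_sum // => y' y'y.
    rewrite mulrDr mulrA.
    by have [_ _ _ _ H] := HE (x', y'); rewrite vE; apply: H; rewrite eq_sym.
  move: b1 b2 b3 c1.
  set G := (X in _ <= 12 / _ * X); rewrite -/G.
  set B1 := \sum_(x' | x' != x) (_ + _); rewrite -/B1.
  set B2 := \sum_(y' | y' != y) (_ + _); rewrite -/B2.
  set B3 := \sum_(x' | x' != x) \sum_(y' | _) (_ + _); rewrite -/B3.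
  set S1 := \sum_(x' | x' != x) dot _ _; rewrite -/S1.
  set S2 := \sum_(y' | y' != y) dot _ _; rewrite -/S2.
  set S3 := \sum_(x' | x' != x) \sum_(y' | _) dot _ _; rewrite -/S3.
  by move=> *; lra.
Qed.

(** The pointwise bound says that one form [M] is nonnegative on every vector; its trace against the
    state [A] is then nonnegative too, with [\tr A = 1] in place of [dot h h]. *)
Lemma mac_decoder_trace (t1 : T1) (t2 : T2) : exists L : T1 -> T2 -> 'M[R]_n,
  [/\ forall x y, psd (L x y), \sum_x \sum_y L x y = 1%:M &
   forall x y A, psd A -> \tr A = 1 -> 1 - \tr (L x y *m A) <=
    48 / del ^+ 2 * ((1 - \tr (P1 x y *m A)) + (1 - \tr (P2 x y *m A))
        + (1 - \tr (P3 x y *m A)))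
    + 16 * (\sum_(x' | x' != x) (\tr (P1 x' y *m A) + s)
      + \sum_(y' | y' != y) (\tr (P2 x y' *m A) + s)
      + \sum_(x' | x' != x) \sum_(y' | y' != y) (\tr (P3 x' y' *m A) + s))
    + 4 * del ^+ 2].
Proof.
have [L [pL sL eL]] := mac_decoder t1 t2; exists L; split=> // x y A pA trA.
pose M := (48 / del ^+ 2) *: ((1%:M - P1 x y) + (1%:M - P2 x y) + (1%:M - P3 x y))
  + 16 *: (\sum_(x' | x' != x) (P1 x' y + s%:M) + \sum_(y' | y' != y) (P2 x y' + s%:M)
    + \sum_(x' | x' != x) \sum_(y' | y' != y) (P3 x' y' + s%:M))
  + (4 * del ^+ 2)%:M - (1%:M - L x y).
have d1 (h : 'cV_n) (P : 'M_n) : dot h ((P + s%:M) *m h) = dot h (P *m h) + s * dot h h.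
  by rewrite !dotL.
rewrite -subr_ge0; have := @mxtrace_psd_ge0 _ _ M A _ pA.
have trN (B : 'M[R]_n) : \tr (- B) = - \tr B by rewrite linearN.
have t1' (P : 'M_n) : \tr ((P + s%:M) *m A) = \tr (P *m A) + s.
  by rewrite mulmxDl mul_scalar_mx mxtraceD mxtraceZ trA mulr1.
have -> : \tr (M *m A) = 48 / del ^+ 2 * ((1 - \tr (P1 x y *m A)) + (1 - \tr (P2 x y *m A))
        + (1 - \tr (P3 x y *m A)))
    + 16 * (\sum_(x' | x' != x) (\tr (P1 x' y *m A) + s)
      + \sum_(y' | y' != y) (\tr (P2 x y' *m A) + s)
      + \sum_(x' | x' != x) \sum_(y' | y' != y) (\tr (P3 x' y' *m A) + s))
    + 4 * del ^+ 2 - (1 - \tr (L x y *m A)).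
  rewrite /M !(mulmxDl, mulNmx) -!scalemxAl !mul_scalar_mx !(mulmxDl, mulNmx) !mul1mx !mulmx_suml.
  rewrite !(mxtraceD, trN, mxtraceZ) trA !mulr1 !raddf_sum /=.
  congr (_ + 16 * (_ + _ + _) + _ + _); apply: eq_bigr => i _; rewrite ?t1' //.
  by rewrite mulmx_suml raddf_sum; apply: eq_bigr => j _; rewrite /= t1'.
apply=> h; have := eL x y h; rewrite -subr_ge0; congr (_ <= _).
rewrite /M !(mulmxDl, mulNmx) -!scalemxAl !mul_scalar_mx !(mulmxDl, mulNmx) !mul1mx !mulmx_suml.
rewrite !(dotDr, dotNr, dotZr) !dot_sumr.
rewrite mul1r; congr (_ + 16 * (_ + _ + _) + _ - _); apply: eq_bigr => i _; rewrite ?d1 //.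
by rewrite mulmx_suml dot_sumr; apply: eq_bigr => j _; rewrite d1.
Qed.

End MacDecoding.

(** * Averages over codebooks with independent entries *)

Section Average.
Variables (R : realFieldType) (T X : finType) (p : X -> R).
Hypothesis p_sum1 : \sum_x p x = 1.

Definition iid (f : {ffun T -> X}) : R := \prod_t p (f t).

Lemma iid_ge0 f : (forall x, 0 <= p x) -> 0 <= iid f.
Proof. by move=> p0; apply: prodr_ge0. Qed.

(** Distributivity of the product over positions. Taking [c] to be an indicator at chosen positions
    and 1 elsewhere yields the marginals. *)
Lemma sum_iid_prod (c : T -> X -> R) :
  \sum_f iid f * \prod_t c t (f t) = \prod_t \sum_x p x * c t x.
Proof. by rewrite bigA_distr_bigA; apply: eq_bigr => f _; rewrite -big_split. Qed.

Lemma sum_iid : \sum_f iid f = 1.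
Proof.
have := sum_iid_prod (fun=> fun=> 1); rewrite [RHS]big1 => [<- | t _].
  by apply: eq_bigr => f _; rewrite big1 // mulr1.
by rewrite -[RHS]p_sum1; apply: eq_bigr => x _; rewrite mulr1.
Qed.

Lemma sum_delta (F : X -> R) y : \sum_x F x * (x == y)%:R = F y.
Proof.
rewrite (bigD1 y) //= eqxx mulr1 big1 ?addr0 // => x /negPf ->; exact: mulr0.
Qed.

(** By linearity in [phi] it is enough to treat indicator functions. *)
Lemma sum_iid_at1 a (phi : X -> R) : \sum_f iid f * phi (f a) = \sum_x p x * phi x.
Proof.
have H x : \sum_f iid f * (f a == x)%:R = p x.
  transitivity (\sum_f iid f * \prod_t (if t == a then (f t == x)%:R else 1)).
    apply: eq_bigr => f _; congr (_ * _).
    by rewrite (bigD1 a) //= eqxx big1 ?mulr1 // => t /negPf ->.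
  rewrite (sum_iid_prod (fun t z => if t == a then (z == x)%:R else 1)).
  rewrite (bigD1 a) //= eqxx sum_delta big1 ?mulr1 // => t /negPf ->.
  by rewrite -[RHS]p_sum1; apply: eq_bigr => z _; rewrite mulr1.
transitivity (\sum_f \sum_x phi x * (iid f * (f a == x)%:R)).
  apply: eq_bigr => f _; rewrite mulrC -(sum_delta (fun x => phi x * iid f)).
  by apply: eq_bigr => x _; rewrite eq_sym mulrA.
by rewrite exchange_big /=; apply: eq_bigr => x _; rewrite -mulr_sumr H mulrC.
Qed.

Lemma sum_iid_at2 a b (phi : X -> X -> R) : a != b ->
  \sum_f iid f * phi (f a) (f b) = \sum_x p x * \sum_y p y * phi x y.
Proof.
move=> ab.
have H x y : \sum_f iid f * ((f a == x)%:R * (f b == y)%:R) = p x * p y.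
  pose c t z : R := if t == a then (z == x)%:R else if t == b then (z == y)%:R else 1.
  transitivity (\sum_f iid f * \prod_t c t (f t)).
    apply: eq_bigr => f _; congr (_ * _).
    rewrite (bigD1 a) //= (bigD1 b) 1?eq_sym //= /c eqxx (negPf (_ : b != a)) 1?eq_sym // eqxx.
    by rewrite big1 ?mulr1 // => t /andP [/negPf -> /negPf ->].
  rewrite sum_iid_prod (bigD1 a) //= (bigD1 b) 1?eq_sym //= /c eqxx.
  rewrite (negPf (_ : b != a)) 1?eq_sym // eqxx !sum_delta.
  rewrite big1 ?mulr1 // => t /andP [/negPf -> /negPf ->].
  by rewrite -[RHS]p_sum1; apply: eq_bigr => z _; rewrite mulr1.
transitivity (\sum_f \sum_x \sum_y phi x y * (iid f * ((f a == x)%:R * (f b == y)%:R))).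
  apply: eq_bigr => f _.
  transitivity (\sum_x (iid f * phi x (f b)) * (x == f a)%:R); first by rewrite sum_delta.
  apply: eq_bigr => x _.
  transitivity (\sum_y (iid f * phi x y * (x == f a)%:R) * (y == f b)%:R).
    by rewrite sum_delta.
  by apply: eq_bigr => y _; rewrite ![_ == f _]eq_sym; ring.
rewrite exchange_big /=; apply: eq_bigr => x _; rewrite exchange_big mulr_sumr /=.
by apply: eq_bigr => y _; rewrite -mulr_sumr H; ring.
Qed.

End Average.
End RandomCode.

(** * Existence of a good code by averaging *)

Module CodeExistence.
Import ssreflect ssrfun ssrbool eqtype ssrnat seq choice fintype finfun bigop.
Import order ssralg ssrnum zmodp matrix mxalgebra ring lra.
Import RealForms Decoder MacDecoder RandomCode.
Set Implicit Arguments.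
Unset Strict Implicit.
Unset Printing Implicit Defensive.
Import Order.TTheory GRing.Theory Num.Theory.
Local Open Scope ring_scope.

Lemma exists_le_average (R : realFieldType) (I : finType) (w F : I -> R) c :
  (forall i, 0 <= w i) -> \sum_i w i = 1 -> \sum_i w i * F i <= c -> exists i, F i <= c.
Proof.
move=> w0 w1 avg; apply/existsP; apply: contraT; rewrite negb_exists => /forallP H.
have Fc i : 0 <= F i - c by rewrite subr_ge0 ltW // ltNge H.
have S0 : \sum_i w i * (F i - c) = 0.
  apply/le_anti; rewrite sumr_ge0 ?andbT; last by move=> i _; rewrite mulr_ge0.
  under eq_bigr do rewrite mulrBr.
  by rewrite sumrB -mulr_suml w1 mul1r subr_le0.
have : \sum_i w i = 0.
  apply: big1 => i _; move/eqP: S0; rewrite psumr_eq0; last by move=> j _; rewrite mulr_ge0.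
  move=> /allP /(_ i (mem_index_enum i)) /=; rewrite mulf_eq0 subr_eq0 => /orP [/eqP //|/eqP Fi].
  by have := H i; rewrite Fi lexx.
by rewrite w1 => /eqP; rewrite oner_eq0.
Qed.

Section Codes.
Variables (R : realFieldType) (n : nat) (U X Y T1 T2 : finType).
Variables (pu : U -> R) (px : U -> X -> R) (py : U -> Y -> R).
Hypothesis pu0 : forall u, 0 <= pu u.
Hypothesis px0 : forall u x, 0 <= px u x.
Hypothesis py0 : forall u y, 0 <= py u y.
Hypothesis pu1 : \sum_u pu u = 1.
Hypothesis px1 : forall u, \sum_x px u x = 1.
Hypothesis py1 : forall u, \sum_y py u y = 1.

(* Expectation over a random [u] and, given [u], independent codebooks with i.i.d. entries. *)
Definition expect (F : U -> {ffun T1 -> X} -> {ffun T2 -> Y} -> R) : R :=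
  \sum_u pu u * \sum_f iid (px u) f * \sum_g iid (py u) g * F u f g.

Lemma expectD F G : expect (fun u f g => F u f g + G u f g) = expect F + expect G.
Proof.
rewrite /expect -big_split; apply: eq_bigr => u _ /=; rewrite -mulrDr -big_split.
congr (_ * _); apply: eq_bigr => f _ /=; rewrite -mulrDr -big_split.
by congr (_ * _); apply: eq_bigr => g _ /=; rewrite mulrDr.
Qed.

Lemma expectZ a F : expect (fun u f g => a * F u f g) = a * expect F.
Proof.
rewrite /expect mulr_sumr; apply: eq_bigr => u _; rewrite [RHS]mulrCA; congr (_ * _).
rewrite mulr_sumr; apply: eq_bigr => f _; rewrite [RHS]mulrCA; congr (_ * _).
by rewrite mulr_sumr; apply: eq_bigr => g _; rewrite mulrCA.
Qed.

Lemma expectN F : expect (fun u f g => - F u f g) = - expect F.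
Proof.
rewrite -mulN1r -expectZ /expect; apply: eq_bigr => u _; congr (_ * _); apply: eq_bigr => f _.
by congr (_ * _); apply: eq_bigr => g _; rewrite mulN1r.
Qed.

Lemma expect_cst c : expect (fun=> fun=> fun=> c) = c.
Proof.
rewrite /expect -[RHS]mul1r -pu1 mulr_suml; apply: eq_bigr => u _; congr (_ * _).
rewrite -[RHS]mul1r -(sum_iid T1 (px1 u)) mulr_suml; apply: eq_bigr => f _; congr (_ * _).
by rewrite -mulr_suml (sum_iid T2 (py1 u)) mul1r.
Qed.

Lemma expect_sum (I : finType) (P : pred I) F :
  expect (fun u f g => \sum_(i | P i) F i u f g) = \sum_(i | P i) expect (F i).
Proof.
rewrite /expect exchange_big /=; apply: eq_bigr => u _; rewrite -mulr_sumr; congr (_ * _).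
rewrite exchange_big /=; apply: eq_bigr => f _; rewrite -mulr_sumr; congr (_ * _).
by rewrite exchange_big /=; apply: eq_bigr => g _; rewrite -mulr_sumr.
Qed.

(** This and the next three lemmas evaluate the expectation when the tested pair is the transmitted
    one, errs in the first message, in the second, or in both. Primed variables stand for tested
    symbols drawn independently of the transmitted ones. *)
Lemma expect_at x y (phi : U -> X -> Y -> R) : expect (fun u f g => phi u (f x) (g y)) =
  \sum_u pu u * \sum_a px u a * \sum_b py u b * phi u a b.
Proof.
rewrite /expect; apply: eq_bigr => u _; congr (_ * _).
rewrite -(sum_iid_at1 (px1 u) x (fun a => \sum_b py u b * phi u a b)).
by apply: eq_bigr => f _; rewrite (sum_iid_at1 (py1 u)).
Qed.

Lemma expect_at1 x x' y (phi : U -> X -> X -> Y -> R) : x' != x ->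
  expect (fun u f g => phi u (f x') (f x) (g y)) =
  \sum_u pu u * \sum_a' px u a' * \sum_a px u a * \sum_b py u b * phi u a' a b.
Proof.
move=> xx; rewrite /expect; apply: eq_bigr => u _; congr (_ * _).
rewrite -(sum_iid_at2 (px1 u) (fun a' a => \sum_b py u b * phi u a' a b) xx).
by apply: eq_bigr => f _; rewrite (sum_iid_at1 (py1 u)).
Qed.

Lemma expect_at2 x y y' (phi : U -> X -> Y -> Y -> R) : y' != y ->
  expect (fun u f g => phi u (f x) (g y') (g y)) =
  \sum_u pu u * \sum_a px u a * \sum_b' py u b' * \sum_b py u b * phi u a b' b.
Proof.
move=> yy; rewrite /expect; apply: eq_bigr => u _; congr (_ * _).
rewrite -(sum_iid_at1 (px1 u) x
  (fun a => \sum_b' py u b' * \sum_b py u b * phi u a b' b)).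
by apply: eq_bigr => f _; rewrite (sum_iid_at2 (py1 u) _ yy).
Qed.

Lemma expect_at12 x x' y y' (phi : U -> X -> X -> Y -> Y -> R) : x' != x -> y' != y ->
  expect (fun u f g => phi u (f x') (f x) (g y') (g y)) =
  \sum_u pu u * \sum_a' px u a' * \sum_a px u a *
    \sum_b' py u b' * \sum_b py u b * phi u a' a b' b.
Proof.
move=> xx yy; rewrite /expect; apply: eq_bigr => u _; congr (_ * _).
rewrite -(sum_iid_at2 (px1 u)
  (fun a' a => \sum_b' py u b' * \sum_b py u b * phi u a' a b' b) xx).
by apply: eq_bigr => f _; rewrite (sum_iid_at2 (py1 u) _ yy).
Qed.

Lemma exists_le_expect F c : expect F <= c -> exists u f g, F u f g <= c.
Proof.
move=> /(exists_le_average pu0 pu1) [u /(exists_le_average (fun f => iid_ge0 f (px0 u)) (sum_iid T1 (px1 u)))].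
move=> [f /(exists_le_average (fun g => iid_ge0 g (py0 u)) (sum_iid T2 (py1 u)))] [g H].
by exists u, f, g.
Qed.

Variables (A : X -> Y -> 'M[R]_n) (Q1 Q2 Q3 : U -> X -> Y -> 'M[R]_n).
Hypothesis psdA : forall x y, psd (A x y).
Hypothesis trA : forall x y, \tr (A x y) = 1.
Hypothesis eff1 : forall u x y, effect (Q1 u x y).
Hypothesis eff2 : forall u x y, effect (Q2 u x y).
Hypothesis eff3 : forall u x y, effect (Q3 u x y).
Variables (eps b1 b2 b3 s del : R).
Hypothesis s_gt0 : 0 < s.
Hypothesis del_gt0 : 0 < del.
Hypothesis del_le1 : del <= 1.
Let hit (Q : U -> X -> Y -> 'M[R]_n) :=
  \sum_u pu u * \sum_a px u a * \sum_b py u b * \tr (Q u a b *m A a b).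
Hypothesis hit1 : 1 - eps <= hit Q1.
Hypothesis hit2 : 1 - eps <= hit Q2.
Hypothesis hit3 : 1 - eps <= hit Q3.
Hypothesis false1 : \sum_u pu u * \sum_a' px u a' * \sum_a px u a * \sum_b py u b *
  \tr (Q1 u a' b *m A a b) <= b1.
Hypothesis false2 : \sum_u pu u * \sum_a px u a * \sum_b' py u b' * \sum_b py u b *
  \tr (Q2 u a b' *m A a b) <= b2.
Hypothesis false3 : \sum_u pu u * \sum_a' px u a' * \sum_a px u a * \sum_b' py u b' *
  \sum_b py u b * \tr (Q3 u a' b' *m A a b) <= b3.
Hypothesis b_ge0 : [/\ 0 <= b1, 0 <= b2 & 0 <= b3].

Lemma sum_neq_le (T : finType) (t : T) c (F : T -> R) : 0 <= c ->
  (forall i, i != t -> F i <= c) -> \sum_(i | i != t) F i <= #|T|%:R * c.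
Proof.
move=> c0 H; apply: (le_trans (ler_sum _ H)).
by rewrite sumr_const mulr_natl ler_wpMn2l // max_card.
Qed.

(** The decoder depends on the code, but its error bound [err] is an explicit function of the
    codebooks. The bound is therefore averaged first, a value [u] and a code are fixed, and only
    then is the decoder built. *)
Lemma random_mac_code (t1 : T1) (t2 : T2) :
  exists (f : T1 -> X) (g : T2 -> Y) (L : T1 -> T2 -> 'M[R]_n),
  [/\ forall x y, psd (L x y), \sum_x \sum_y L x y = 1%:M &
   \sum_x \sum_y (1 - \tr (L x y *m A (f x) (g y))) <= #|T1|%:R * #|T2|%:R *
    (144 * eps / del ^+ 2 + 16 * (#|T1|%:R * (b1 + s) + #|T2|%:R * (b2 + s)
      + #|T1|%:R * (#|T2|%:R * (b3 + s))) + 4 * del ^+ 2)].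
Proof.
pose err x y u (f : {ffun T1 -> X}) (g : {ffun T2 -> Y}) :=
    48 / del ^+ 2 * ((1 - \tr (Q1 u (f x) (g y) *m A (f x) (g y)))
        + (1 - \tr (Q2 u (f x) (g y) *m A (f x) (g y)))
        + (1 - \tr (Q3 u (f x) (g y) *m A (f x) (g y))))
    + 16 * (\sum_(x' | x' != x) (\tr (Q1 u (f x') (g y) *m A (f x) (g y)) + s)
      + \sum_(y' | y' != y) (\tr (Q2 u (f x) (g y') *m A (f x) (g y)) + s)
      + \sum_(x' | x' != x) \sum_(y' | y' != y) (\tr (Q3 u (f x') (g y') *m A (f x) (g y)) + s))
    + 4 * del ^+ 2.
have [k1 k2 k3] := b_ge0; have s0 := ltW s_gt0.
have avg x y : expect (err x y) <= 144 * eps / del ^+ 2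
    + 16 * (#|T1|%:R * (b1 + s) + #|T2|%:R * (b2 + s)
      + #|T1|%:R * (#|T2|%:R * (b3 + s))) + 4 * del ^+ 2.
  rewrite /err !(expectD, expectZ, expect_cst, expectN).
  rewrite !lerD //.
  - rewrite (expect_at x y (fun u a b => \tr (Q1 u a b *m A a b))).
    rewrite (expect_at x y (fun u a b => \tr (Q2 u a b *m A a b))).
    rewrite (expect_at x y (fun u a b => \tr (Q3 u a b *m A a b))).
    (* Each of the three tests misses the true pair with average probability at most [eps]. *)
    have -> : 144 * eps / del ^+ 2 = 48 / del ^+ 2 * (eps + eps + eps) by ring.
    apply: ler_wpM2l; first by rewrite divr_ge0 // sqr_ge0.
    by rewrite -!/(hit _); move: hit1 hit2 hit3 => *; lra.
  - rewrite ler_wpM2l // !lerD //.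
    + rewrite expect_sum; apply: sum_neq_le => [|x' xx]; first exact: addr_ge0.
      rewrite expectD expect_cst lerD2r.
      by rewrite (expect_at1 y (fun u a' a b => \tr (Q1 u a' b *m A a b)) xx).
    + rewrite expect_sum; apply: sum_neq_le => [|y' yy]; first exact: addr_ge0.
      rewrite expectD expect_cst lerD2r.
      by rewrite (expect_at2 x (fun u a b' b => \tr (Q2 u a b' *m A a b)) yy).
    + rewrite expect_sum; apply: sum_neq_le => [|x' xx]; first by rewrite mulr_ge0 // addr_ge0.
      rewrite expect_sum; apply: sum_neq_le => [|y' yy]; first exact: addr_ge0.
      rewrite expectD expect_cst lerD2r.
      by rewrite (expect_at12 (fun u a' a b' b => \tr (Q3 u a' b' *m A a b)) xx yy).
have tot : expect (fun u f g => \sum_x \sum_y err x y u f g) <= #|T1|%:R * #|T2|%:R *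
    (144 * eps / del ^+ 2 + 16 * (#|T1|%:R * (b1 + s) + #|T2|%:R * (b2 + s)
      + #|T1|%:R * (#|T2|%:R * (b3 + s))) + 4 * del ^+ 2).
  rewrite expect_sum.
  under eq_bigr do rewrite expect_sum.
  apply: (le_trans (ler_sum _ (fun x _ => ler_sum _ (fun y _ => avg x y)))).
  rewrite !sumr_const; set c := (X in X *+ _ *+ _).
  by rewrite -mulrnA -[c *+ _]mulr_natl mulnC natrM.
have [u [f [g H]]] := exists_le_expect tot.
have [L [pL sL eL]] := @mac_decoder_trace R n T1 T2
  (fun x y => Q1 u (f x) (g y)) (fun x y => Q2 u (f x) (g y)) (fun x y => Q3 u (f x) (g y)) s del
  (fun _ _ => eff1 _ _ _) (fun _ _ => eff2 _ _ _) (fun _ _ => eff3 _ _ _)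
  s_gt0 del_gt0 del_le1 t1 t2.
exists f, g, L; split => //; apply: le_trans H.
by apply: ler_sum => x _; apply: ler_sum => y _; apply: eL.
Qed.

End Codes.
End CodeExistence.

(** * Compactness of effects and existence of optimal tests *)

Module OptimalTest.
Import ssreflect ssrfun ssrbool eqtype ssrnat seq choice fintype finfun bigop.
Import order ssralg ssrnum zmodp matrix mxalgebra ring lra interval.
Import boolp classical_sets reals topology normedtype derive.
Import numFieldNormedType.Exports.
Import RealForms Decoder MacDecoder.
Set Implicit Arguments.
Unset Strict Implicit.
Unset Printing Implicit Defensive.
Import Order.TTheory GRing.Theory Num.Theory.
Local Open Scope classical_set_scope.
Local Open Scope ring_scope.

Section Optimal.
Variables (R : realType) (n : nat).
Implicit Types (v : 'rV[R]_(n * n)) (P A : 'M[R]_n).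

Lemma mxtrace_mulE P A : \tr (P *m A) = \sum_i \sum_j A j i * P i j.
Proof.
by apply: eq_bigr => i _; rewrite mxE; apply: eq_bigr => j _; rewrite mulrC.
Qed.

Lemma dot_mulmxE (x : 'cV[R]_n) P :
  dot x (P *m x) = \sum_i \sum_j x i 0 * x j 0 * P i j.
Proof.
rewrite dotE; apply: eq_bigr => i _; rewrite mxE mulr_sumr; apply: eq_bigr => j _.
by rewrite [P i j * _]mulrC mulrA.
Qed.

Lemma continuous_entries (c : 'I_n -> 'I_n -> R) :
  continuous (fun v => \sum_i \sum_j c i j * (vec_mx v : 'M[R]_n) i j).
Proof.
apply: continuous_big => [|i _]; first exact: add_continuous.
apply: continuous_big => [|j _]; first exact: add_continuous.
have cij : continuous (fun v => (vec_mx v : 'M[R]_n) i j).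
  rewrite (_ : (fun v => _) = fun v => v 0 (mxvec_index i j)); first exact: coord_continuous.
  by apply/funext => v; rewrite mxE.
by move=> v; apply: continuousM; [exact: cst_continuous | exact: cij].
Qed.

Lemma closed_entries_ge (c : 'I_n -> 'I_n -> R) a :
  closed [set v | a <= \sum_i \sum_j c i j * (vec_mx v : 'M[R]_n) i j].
Proof.
apply: (@preimage_closed _ _ (fun v => \sum_i \sum_j c i j * (vec_mx v : 'M[R]_n) i j)
  [set x | a <= x]); last exact: closed_ge.
by move=> v _; apply: continuous_entries.
Qed.

Lemma entry_sumE P i j : P i j = \sum_i' \sum_j' ((i' == i) && (j' == j))%:R * P i' j'.
Proof.
rewrite (bigD1 i) //= (bigD1 j) //= !eqxx mul1r big1 ?addr0 => [|j' /negPf ->]; last first.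
  by rewrite andbF mul0r.
by rewrite big1 ?addr0 // => i' /negPf ->; rewrite big1 // => j' _; rewrite mul0r.
Qed.

Lemma effect_entry P i j : effect P -> -1 <= P i j <= 1.
Proof.
move=> eP; have b k : P k k <= 1.
  have := effect_le1 (delta_mx k 0) eP.
  by rewrite dot_delta -{2}[delta_mx k 0]mul1mx dot_delta mxE eqxx.
have := psd_amgm 1 (delta_mx i 0) (delta_mx j 0) (proj1 eP).
have := psd_amgm (-1) (delta_mx i 0) (delta_mx j 0) (proj1 eP).
rewrite !dot_delta; have := b i; have := b j => *; apply/andP; split; lra.
Qed.

Lemma compact_effects : compact [set v : 'rV[R]_(n * n) | effect (vec_mx v : 'M[R]_n)].
Proof.
(* The effects form a closed subset of a cube. Symmetry, positivity and [P <= 1] are families of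
   weak linear inequalities in the entries; symmetry is the inequality for [(i, j)] together with
   the one for [(j, i)]. *)
apply: (@subclosed_compact _ _ [set v : 'rV[R]_(n * n) | forall k : 'I_(n * n), `[-1, 1]%classic (v ord0 k)]).
- rewrite (_ : mkset _ = [set v | forall ij : 'I_n * 'I_n,
      0 <= \sum_i \sum_j (((i == ij.1) && (j == ij.2))%:R - ((i == ij.2) && (j == ij.1))%:R)
        * (vec_mx v : 'M[R]_n) i j] `&`
    ([set v | forall x : 'cV[R]_n, 0 <= \sum_i \sum_j x i 0 * x j 0 * (vec_mx v : 'M[R]_n) i j] `&`
     [set v | forall x : 'cV[R]_n,
        - dot x x <= \sum_i \sum_j - (x i 0 * x j 0) * (vec_mx v : 'M[R]_n) i j])).
    apply: closedI; last apply: closedI.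
    + rewrite (_ : mkset _ = \bigcap_(ij in [set: 'I_n * 'I_n])
        [set v | 0 <= \sum_i \sum_j (((i == ij.1) && (j == ij.2))%:R
          - ((i == ij.2) && (j == ij.1))%:R) * (vec_mx v : 'M[R]_n) i j]).
        by apply: closed_bigI => ij _; apply: closed_entries_ge.
      by apply/seteqP; split => v H; [move=> ij _; apply: H | move=> ij; apply: (H ij)].
    + rewrite (_ : mkset _ = \bigcap_(x in [set: 'cV[R]_n])
        [set v | 0 <= \sum_i \sum_j x i 0 * x j 0 * (vec_mx v : 'M[R]_n) i j]).
        by apply: closed_bigI => x _; apply: closed_entries_ge.
      by apply/seteqP; split => v H; [move=> x _; apply: H | move=> x; apply: (H x)].
    + rewrite (_ : mkset _ = \bigcap_(x in [set: 'cV[R]_n])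
        [set v | - dot x x <= \sum_i \sum_j - (x i 0 * x j 0) * (vec_mx v : 'M[R]_n) i j]).
        by apply: closed_bigI => x _; apply: closed_entries_ge.
      by apply/seteqP; split => v H; [move=> x _; apply: H | move=> x; apply: (H x)].
  have sE (P : 'M[R]_n) i j : \sum_i' \sum_j' (((i' == i) && (j' == j))%:R
      - ((i' == j) && (j' == i))%:R) * P i' j' = P i j - P j i.
    rewrite (entry_sumE P i j) (entry_sumE P j i) -sumrB; apply: eq_bigr => i' _.
    by rewrite -sumrB; apply: eq_bigr => j' _; rewrite mulrBl.
  have nE (P : 'M[R]_n) (x : 'cV_n) :
      \sum_i \sum_j - (x i 0 * x j 0) * P i j = - dot x (P *m x).
    rewrite dot_mulmxE -sumrN; apply: eq_bigr => i _; rewrite -sumrN.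
    by apply: eq_bigr => j _; rewrite mulNr.
  apply/seteqP; split => v /=.
    move=> eP; split; [|split].
    + by move=> [i j]; rewrite sE subr_ge0 /= -{1}(proj1 (proj1 eP)) mxE.
    + by move=> x; rewrite -dot_mulmxE; apply: (proj2 (proj1 eP)).
    + by move=> x; rewrite nE lerN2; apply: effect_le1.
  move=> [H1 [H2 H3]]; apply: effectP.
    apply/matrixP => i j; rewrite mxE; apply/le_anti.
    by have := H1 (i, j); have := H1 (j, i); rewrite !sE !subr_ge0 /= => -> ->.
  by move=> x; have := H3 x; rewrite nE lerN2 => ->; rewrite dot_mulmxE H2.
- exact: (@rV_compact R (n * n) (fun=> `[-1, 1]%classic) (fun=> @segment_compact R (-1) 1)).
- move=> v /= eP k; rewrite /= in_itv /=.
  have := effect_entry (enum_val (cast_ord (esym (mxvec_cast n n)) k)).1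
    (enum_val (cast_ord (esym (mxvec_cast n n)) k)).2 eP.
  rewrite mxE; suff -> : mxvec_index (enum_val (cast_ord (esym (mxvec_cast n n)) k)).1
    (enum_val (cast_ord (esym (mxvec_cast n n)) k)).2 = k by [].
  by rewrite /mxvec_index -surjective_pairing enum_valK cast_ordKV.
Qed.

(** A continuous function attains its minimum on a nonempty compact set; thus the maximum in the
    hypothesis-testing divergence is attained. *)
Lemma optimal_test (A B : 'M[R]_n) c : (exists2 P, effect P & c <= \tr (P *m A)) ->
  exists2 P, effect P /\ c <= \tr (P *m A) &
    forall P', effect P' -> c <= \tr (P' *m A) -> \tr (P *m B) <= \tr (P' *m B).
Proof.
move=> [P0 e0 c0].
pose K := [set v : 'rV[R]_(n * n) | effect (vec_mx v : 'M[R]_n)] `&`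
  [set v | c <= \sum_i \sum_j A j i * (vec_mx v : 'M[R]_n) i j].
have Kne : K !=set0.
  by exists (mxvec P0); rewrite /K; split => /=; rewrite mxvecK // -mxtrace_mulE.
have Kc : compact K.
  apply: compact_closedI; [exact: compact_effects | exact: closed_entries_ge].
have [|v vK vmin] := @EVT_min_rV R _ (fun v => \sum_i \sum_j B j i * (vec_mx v : 'M[R]_n) i j) K Kne Kc.
  by apply: continuous_subspaceT => v; apply: continuous_entries.
have [ev cv] := set_mem vK.
exists (vec_mx v); first by rewrite mxtrace_mulE.
move=> P' eP' cP'; have := vmin (mxvec P'); rewrite !mxtrace_mulE mxvecK; apply.
by apply/mem_set; rewrite /K; split => /=; rewrite mxvecK // -mxtrace_mulE.
Qed.

End Optimal.
End OptimalTest.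

(** * Entries of the joint state and of the reference states *)

Module CqEntries.
Import Lra Lia List Arith Bool.
Import Defs.
Local Open Scope R_scope.

Lemma C_ext (a b : C) : re a = re b -> im a = im b -> a = b.
Proof. destruct a, b; simpl; intros; subst; reflexivity. Qed.

Ltac cring := intros; apply C_ext; simpl; ring.

Lemma C_ring_theory : ring_theory C0 C1 Cadd Cmul (fun a b => Cadd a (Cneg b)) Cneg (@eq C).
Proof. constructor; cring. Qed.
Add Ring C_ring : C_ring_theory.

Lemma RtoC_mul a b : RtoC (a * b) = Cmul (RtoC a) (RtoC b).
Proof. cring. Qed.

Lemma csum_S n f : csum (S n) f = Cadd (csum n f) (f n).
Proof.
  unfold csum. rewrite seq_S, map_app, fold_right_app. simpl.
  generalize (map f (seq 0 n)) as l. induction l as [|a l IH]; simpl; [ring|].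
  rewrite IH; ring.
Qed.

Lemma rsum_S n f : rsum (S n) f = rsum n f + f n.
Proof.
  unfold rsum. rewrite seq_S, map_app, fold_right_app. simpl.
  generalize (map f (seq 0 n)) as l. induction l as [|a l IH]; simpl; [ring|].
  rewrite IH; ring.
Qed.

Lemma csum_ext n f g : (forall k, (k < n)%nat -> f k = g k) -> csum n f = csum n g.
Proof.
  induction n as [|n IH]; intro H; [reflexivity|].
  rewrite !csum_S, IH, H by (intros; try apply H; lia). reflexivity.
Qed.

Lemma csum_0 n f : (forall k, (k < n)%nat -> f k = C0) -> csum n f = C0.
Proof.
  induction n as [|n IH]; intro H; [reflexivity|].
  rewrite csum_S, IH, H by (intros; try apply H; lia). ring.
Qed.

Lemma csum_single n a f : (a < n)%nat ->
  (forall k, (k < n)%nat -> k <> a -> f k = C0) -> csum n f = f a.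
Proof.
  induction n as [|n IH]; intros Ha H; [lia|]. rewrite csum_S.
  destruct (Nat.eq_dec a n) as [->|Hn].
  - rewrite csum_0 by (intros; apply H; lia). ring.
  - rewrite IH, (H n) by (intros; try apply H; lia). ring.
Qed.

Lemma csum_mull n c f : csum n (fun k => Cmul c (f k)) = Cmul c (csum n f).
Proof.
  induction n as [|n IH]; [unfold csum; simpl; ring|]. rewrite !csum_S, IH; ring.
Qed.

Lemma csum_add n f g : csum n (fun k => Cadd (f k) (g k)) = Cadd (csum n f) (csum n g).
Proof.
  induction n as [|n IH]; [unfold csum; simpl; ring|]. rewrite !csum_S, IH; ring.
Qed.

Lemma csum_plus a b f : csum (a + b) f = Cadd (csum a f) (csum b (fun i => f (a + i)%nat)).
Proof.
  induction b as [|b IH]; [rewrite Nat.add_0_r; unfold csum at 3; simpl; ring|].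
  rewrite Nat.add_succ_r, !csum_S, IH; ring.
Qed.

Lemma csum_prod a b f : csum (a * b) f = csum a (fun i => csum b (fun j => f (i * b + j)%nat)).
Proof.
  induction a as [|a IH]; [reflexivity|].
  rewrite csum_S, <- IH, Nat.mul_succ_l, csum_plus. reflexivity.
Qed.

Lemma csum_RtoC n f : csum n (fun k => RtoC (f k)) = RtoC (rsum n f).
Proof.
  induction n as [|n IH]; [reflexivity|]. rewrite csum_S, rsum_S, IH. cring.
Qed.

Lemma div_block d k i : (i < d)%nat -> ((k * d + i) / d = k)%nat.
Proof. intro H. rewrite Nat.div_add_l, Nat.div_small by lia. lia. Qed.

Lemma mod_block d k i : (i < d)%nat -> ((k * d + i) mod d = i)%nat.
Proof. intro H. rewrite Nat.add_comm, Nat.Div0.mod_add. apply Nat.mod_small, H. Qed.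

Lemma kron_block m n A B a b i j : (i < n)%nat -> (j < n)%nat ->
  kron m n A B (a * n + i)%nat (b * n + j)%nat = Cmul (A a b) (B i j).
Proof. intros. unfold kron. rewrite !div_block, !mod_block by assumption. reflexivity. Qed.

Lemma block_lt a b m n : (a < m)%nat -> (b < n)%nat -> (a * n + b < m * n)%nat.
Proof. intros. nia. Qed.

Lemma E_eq a b : E a a b = if (a =? b)%nat then C1 else C0.
Proof. unfold E. rewrite Nat.eqb_refl, (Nat.eqb_sym b). reflexivity. Qed.

Lemma E_neq k a b : k <> a -> E k a b = C0.
Proof.
  intro H. unfold E. destruct (Nat.eqb_spec a k); [congruence|reflexivity].
Qed.

Section Entries.
Variables (nU nX nY dX dY dZ : nat) (Phi : Mat -> Mat)
          (pu : nat -> R) (px py : nat -> nat -> R) (sX sY : nat -> Mat).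
Let W x y := Phi (kron dX dY (sX x) (sY y)).
Let rho := rhoUXYZ nU nX nY dX dY dZ Phi pu px py sX sY.
Hypothesis W_trace : forall x y, (x < nX)%nat -> (y < nY)%nat -> trace dZ (W x y) = C1.
Hypothesis px1 : forall u, (u < nU)%nat -> rsum nX (px u) = 1.
Hypothesis py1 : forall u, (u < nU)%nat -> rsum nY (py u) = 1.

Definition idx u x y i : nat := (((u * nX + x) * nY + y) * dZ + i)%nat.
Let same (u u' x x' y y' : nat) : bool := ((u =? u') && (x =? x') && (y =? y'))%nat.

(** The row labels single out one term of the triple sum, and that term vanishes unless the column
    labels agree with them. *)
Lemma rho_entry u u' x x' y y' i j :
  (u < nU)%nat -> (u' < nU)%nat -> (x < nX)%nat -> (x' < nX)%nat ->
  (y < nY)%nat -> (y' < nY)%nat -> (i < dZ)%nat -> (j < dZ)%nat ->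
  rho (idx u x y i) (idx u' x' y' j) =
  if same u u' x x' y y' then Cmul (RtoC (pu u * px u x * py u y)) (W x y i j) else C0.
Proof.
  intros Hu Hu' Hx Hx' Hy Hy' Hi Hj. unfold rho, rhoUXYZ, Msum, idx, Rscale, Mscale, ketbraUXY.
  assert (K : forall a b c, Cmul (RtoC (pu a * px a b * py a c))
      (kron (nU * nX * nY) dZ
         (kron (nU * nX) nY (kron nU nX (E a) (E b)) (E c)) (Phi (kron dX dY (sX b) (sY c)))
         (((u * nX + x) * nY + y) * dZ + i)%nat (((u' * nX + x') * nY + y') * dZ + j)%nat)
    = Cmul (RtoC (pu a * px a b * py a c))
       (Cmul (Cmul (Cmul (E a u u') (E b x x')) (E c y y')) (W b c i j))).
  { intros. rewrite !kron_block by assumption. reflexivity. }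
  rewrite (csum_single nU u); [|assumption|].
  2:{ intros a _ Ha. apply csum_0; intros b _. apply csum_0; intros c _.
      rewrite K, (E_neq a) by congruence. ring. }
  rewrite (csum_single nX x); [|assumption|].
  2:{ intros b _ Hb. apply csum_0; intros c _. rewrite K, (E_neq b) by congruence. ring. }
  rewrite (csum_single nY y); [|assumption|].
  2:{ intros c _ Hc. rewrite K, (E_neq c) by congruence. ring. }
  rewrite K, !E_eq. unfold same.
  destruct (u =? u')%nat, (x =? x')%nat, (y =? y')%nat; simpl; ring.
Qed.

Let rhou := rho_u nU nX nY dX dY dZ Phi pu px py sX sY.

Section Conditional.
Variable u : nat.
Hypothesis Hu : (u < nU)%nat.
Hypothesis pu_neq0 : pu u <> 0.

Lemma rho_u_entry x x' y y' i j : (x < nX)%nat -> (x' < nX)%nat ->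
  (y < nY)%nat -> (y' < nY)%nat -> (i < dZ)%nat -> (j < dZ)%nat ->
  rhou u ((x * nY + y) * dZ + i)%nat ((x' * nY + y') * dZ + j)%nat =
  if ((x =? x') && (y =? y'))%nat then Cmul (RtoC (px u x * py u y)) (W x y i j) else C0.
Proof.
  intros. unfold rhou, rho_u, Rscale, Mscale. fold rho.
  replace (u * (nX * nY * dZ) + ((x * nY + y) * dZ + i))%nat with (idx u x y i)
    by (unfold idx; ring).
  replace (u * (nX * nY * dZ) + ((x' * nY + y') * dZ + j))%nat with (idx u x' y' j)
    by (unfold idx; ring).
  rewrite rho_entry by assumption. unfold same. rewrite Nat.eqb_refl. simpl.
  destruct ((x =? x') && (y =? y'))%nat; [|ring].
  replace (RtoC (px u x * py u y))
    with (Cmul (RtoC (/ pu u)) (RtoC (pu u * px u x * py u y)))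
    by (rewrite <- RtoC_mul; f_equal; field; assumption).
  ring.
Qed.

Lemma csum_trace c x y : (x < nX)%nat -> (y < nY)%nat ->
  csum dZ (fun i => Cmul (RtoC c) (W x y i i)) = RtoC c.
Proof.
  intros. rewrite csum_mull. fold (trace dZ (W x y)). rewrite W_trace by assumption. cring.
Qed.

Lemma rsum_mull n c f : rsum n (fun k => c * f k) = c * rsum n f.
Proof.
  induction n as [|n IH]; [unfold rsum; simpl; ring|]. rewrite !rsum_S, IH; ring.
Qed.

Lemma rhoX_entry x x' : (x < nX)%nat -> (x' < nX)%nat ->
  rhoX_u nU nX nY dX dY dZ Phi pu px py sX sY u x x' =
  if (x =? x')%nat then RtoC (px u x) else C0.
Proof.
  intros Hx Hx'. unfold rhoX_u, ptrace_last. fold rhou. rewrite csum_prod.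
  rewrite (csum_ext nY _ (fun y => if (x =? x')%nat then RtoC (px u x * py u y) else C0)).
  - destruct (x =? x')%nat; [|apply csum_0; reflexivity].
    rewrite csum_RtoC, rsum_mull, py1 by assumption. f_equal; ring.
  - intros y Hy.
    rewrite (csum_ext dZ _ (fun i => if (x =? x')%nat
       then Cmul (RtoC (px u x * py u y)) (W x y i i) else C0)).
    + destruct (x =? x')%nat; [apply csum_trace; assumption | apply csum_0; reflexivity].
    + intros i Hi.
      replace (x * (nY * dZ) + (y * dZ + i))%nat with ((x * nY + y) * dZ + i)%nat by ring.
      replace (x' * (nY * dZ) + (y * dZ + i))%nat with ((x' * nY + y) * dZ + i)%nat by ring.
      rewrite rho_u_entry, Nat.eqb_refl, andb_true_r by assumption. reflexivity.
Qed.

Lemma rhoYZ_entry y y' i j : (y < nY)%nat -> (y' < nY)%nat -> (i < dZ)%nat -> (j < dZ)%nat ->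
  rhoYZ_u nU nX nY dX dY dZ Phi pu px py sX sY u (y * dZ + i)%nat (y' * dZ + j)%nat =
  if (y =? y')%nat
  then Cmul (RtoC (py u y)) (csum nX (fun a => Cmul (RtoC (px u a)) (W a y i j))) else C0.
Proof.
  intros Hy Hy' Hi Hj. unfold rhoYZ_u, ptrace_first. fold rhou.
  rewrite (csum_ext nX _ (fun a => if (y =? y')%nat
    then Cmul (RtoC (py u y)) (Cmul (RtoC (px u a)) (W a y i j)) else C0)).
  - destruct (y =? y')%nat; [apply csum_mull | apply csum_0; reflexivity].
  - intros a Ha.
    replace (a * (nY * dZ) + (y * dZ + i))%nat with ((a * nY + y) * dZ + i)%nat by ring.
    replace (a * (nY * dZ) + (y' * dZ + j))%nat with ((a * nY + y') * dZ + j)%nat by ring.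
    rewrite rho_u_entry, Nat.eqb_refl by assumption. simpl.
    destruct (y =? y')%nat; [rewrite RtoC_mul; ring | reflexivity].
Qed.

Lemma rhoY_entry y y' : (y < nY)%nat -> (y' < nY)%nat ->
  rhoY_u nU nX nY dX dY dZ Phi pu px py sX sY u y y' =
  if (y =? y')%nat then RtoC (py u y) else C0.
Proof.
  intros Hy Hy'. unfold rhoY_u, ptrace_last.
  rewrite (csum_ext dZ _ (fun i => if (y =? y')%nat
     then Cmul (RtoC (py u y)) (csum nX (fun a => Cmul (RtoC (px u a)) (W a y i i))) else C0))
    by (intros; apply rhoYZ_entry; assumption).
  destruct (y =? y')%nat; [|apply csum_0; reflexivity].
  rewrite csum_mull.
  (* The trace over the output is exchanged with the mixture over [a]; truncation at [n] serves the
     induction. *)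
  assert (S : forall n, (n <= nX)%nat ->
    csum dZ (fun i => csum n (fun a => Cmul (RtoC (px u a)) (W a y i i))) = RtoC (rsum n (px u))).
  { induction n as [|n IH]; intro Hn.
    - apply csum_0; reflexivity.
    - rewrite (csum_ext dZ _ (fun i => Cadd (csum n (fun a => Cmul (RtoC (px u a)) (W a y i i)))
         (Cmul (RtoC (px u n)) (W n y i i)))) by (intros; apply csum_S).
      rewrite csum_add, IH, csum_trace, rsum_S by lia. cring. }
  rewrite S, px1 by lia. cring.
Qed.

Lemma rhoXZ_entry x x' i j : (x < nX)%nat -> (x' < nX)%nat -> (i < dZ)%nat -> (j < dZ)%nat ->
  rhoXZ_u nU nX nY dX dY dZ Phi pu px py sX sY u (x * dZ + i)%nat (x' * dZ + j)%nat =
  if (x =? x')%nat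
  then Cmul (RtoC (px u x)) (csum nY (fun b => Cmul (RtoC (py u b)) (W x b i j))) else C0.
Proof.
  intros Hx Hx' Hi Hj. unfold rhoXZ_u, ptrace_mid. fold rhou.
  rewrite !div_block, !mod_block by assumption.
  rewrite (csum_ext nY _ (fun b => if (x =? x')%nat
    then Cmul (RtoC (px u x)) (Cmul (RtoC (py u b)) (W x b i j)) else C0)).
  - destruct (x =? x')%nat; [apply csum_mull | apply csum_0; reflexivity].
  - intros b Hb.
    replace (x * nY * dZ + b * dZ + i)%nat with ((x * nY + b) * dZ + i)%nat by ring.
    replace (x' * nY * dZ + b * dZ + j)%nat with ((x' * nY + b) * dZ + j)%nat by ring.
    rewrite rho_u_entry, Nat.eqb_refl, andb_true_r by assumption.
    destruct (x =? x')%nat; [rewrite RtoC_mul; ring | reflexivity].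
Qed.

Lemma rhoXY_entry x x' y y' : (x < nX)%nat -> (x' < nX)%nat -> (y < nY)%nat -> (y' < nY)%nat ->
  rhoXY_u nU nX nY dX dY dZ Phi pu px py sX sY u (x * nY + y)%nat (x' * nY + y')%nat =
  if ((x =? x') && (y =? y'))%nat then RtoC (px u x * py u y) else C0.
Proof.
  intros Hx Hx' Hy Hy'. unfold rhoXY_u, ptrace_last. fold rhou.
  rewrite (csum_ext dZ _ (fun i => if ((x =? x') && (y =? y'))%nat
     then Cmul (RtoC (px u x * py u y)) (W x y i i) else C0))
    by (intros; apply rho_u_entry; assumption).
  destruct ((x =? x') && (y =? y'))%nat; [apply csum_trace; assumption | apply csum_0; reflexivity].
Qed.

Lemma rhoZ_entry i j : (i < dZ)%nat -> (j < dZ)%nat ->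
  rhoZ_u nU nX nY dX dY dZ Phi pu px py sX sY u i j =
  csum nX (fun a => csum nY (fun b => Cmul (RtoC (px u a * py u b)) (W a b i j))).
Proof.
  intros Hi Hj. unfold rhoZ_u, ptrace_first. fold rhou. rewrite csum_prod.
  apply csum_ext; intros a Ha. apply csum_ext; intros b Hb.
  rewrite rho_u_entry, !Nat.eqb_refl by assumption. reflexivity.
Qed.

End Conditional.

Lemma refU_entry T u u' x x' y y' i j :
  (u < nU)%nat -> (u' < nU)%nat -> (x < nX)%nat -> (x' < nX)%nat ->
  (y < nY)%nat -> (y' < nY)%nat -> (i < dZ)%nat -> (j < dZ)%nat ->
  refU nU nX nY dZ pu T (idx u x y i) (idx u' x' y' j) =
  if (u =? u')%nat then Cmul (RtoC (pu u))
    (T u ((x * nY + y) * dZ + i)%nat ((x' * nY + y') * dZ + j)%nat) else C0.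
Proof.
  intros Hu Hu' Hx Hx' Hy Hy' Hi Hj. unfold refU, Msum, Rscale, Mscale.
  assert (B : forall x y i, (x < nX)%nat -> (y < nY)%nat -> (i < dZ)%nat ->
     ((x * nY + y) * dZ + i < nX * nY * dZ)%nat).
  { intros. apply block_lt; [apply block_lt|]; assumption. }
  assert (K : forall a, kron nU (nX * nY * dZ) (E a) (T a) (idx u x y i) (idx u' x' y' j) =
     Cmul (E a u u') (T a ((x * nY + y) * dZ + i)%nat ((x' * nY + y') * dZ + j)%nat)).
  { intro a. rewrite <- (kron_block nU (nX * nY * dZ)) by (apply B; assumption).
    f_equal; unfold idx; ring. }
  rewrite (csum_single nU u); [|assumption|].
  - rewrite K, E_eq. destruct (u =? u')%nat; ring.
  - intros a _ Ha. rewrite K, E_neq by congruence. ring.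
Qed.

Lemma Cmul_RtoC_0 z : Cmul (RtoC 0) z = C0.
Proof. cring. Qed.

Ltac same_block :=
  unfold same;
  match goal with |- context [(?a =? ?b)%nat && _ && _] =>
    destruct (Nat.eqb_spec a b) as [<-|]; [simpl | reflexivity] end.

Lemma ref_X_YZ_entry u u' x x' y y' i j :
  (u < nU)%nat -> (u' < nU)%nat -> (x < nX)%nat -> (x' < nX)%nat ->
  (y < nY)%nat -> (y' < nY)%nat -> (i < dZ)%nat -> (j < dZ)%nat ->
  ref_X_YZ nU nX nY dX dY dZ Phi pu px py sX sY (idx u x y i) (idx u' x' y' j) =
  if same u u' x x' y y' then Cmul (RtoC (pu u * px u x * py u y))
    (csum nX (fun a => Cmul (RtoC (px u a)) (W a y i j))) else C0.
Proof.
  intros. unfold ref_X_YZ. rewrite refU_entry by assumption. same_block.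
  (* When [pu u] is 0 the conditional state has no meaning, since it involves [/ pu u], but the
     weight [pu u] annihilates both sides. *)
  destruct (Req_dec (pu u) 0) as [P0|P0].
  { rewrite P0, !Rmult_0_l, !Cmul_RtoC_0. destruct ((x =? x') && (y =? y'))%nat; reflexivity. }
  replace ((x * nY + y) * dZ + i)%nat with (x * (nY * dZ) + (y * dZ + i))%nat by ring.
  replace ((x' * nY + y') * dZ + j)%nat with (x' * (nY * dZ) + (y' * dZ + j))%nat by ring.
  rewrite kron_block, rhoX_entry, rhoYZ_entry by (try apply block_lt; assumption).
  destruct (x =? x')%nat, (y =? y')%nat; simpl; rewrite ?RtoC_mul; ring.
Qed.

Lemma ref_Y_XZ_entry u u' x x' y y' i j :
  (u < nU)%nat -> (u' < nU)%nat -> (x < nX)%nat -> (x' < nX)%nat ->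
  (y < nY)%nat -> (y' < nY)%nat -> (i < dZ)%nat -> (j < dZ)%nat ->
  ref_Y_XZ nU nX nY dX dY dZ Phi pu px py sX sY (idx u x y i) (idx u' x' y' j) =
  if same u u' x x' y y' then Cmul (RtoC (pu u * px u x * py u y))
    (csum nY (fun b => Cmul (RtoC (py u b)) (W x b i j))) else C0.
Proof.
  intros. unfold ref_Y_XZ. rewrite refU_entry by assumption. same_block.
  destruct (Req_dec (pu u) 0) as [P0|P0].
  { rewrite P0, !Rmult_0_l, !Cmul_RtoC_0. destruct ((x =? x') && (y =? y'))%nat; reflexivity. }
  (* The position of [(x, y, i)] is read at that of [(y, x, i)], where the product of the [Y] and
     [XZ] marginals factors. *)
  unfold swap12, swidx. rewrite !div_block, !mod_block by assumption.
  replace ((y * nX + x) * dZ + i)%nat with (y * (nX * dZ) + (x * dZ + i))%nat by ring.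
  replace ((y' * nX + x') * dZ + j)%nat with (y' * (nX * dZ) + (x' * dZ + j))%nat by ring.
  rewrite kron_block, rhoY_entry, rhoXZ_entry by (try apply block_lt; assumption).
  destruct (x =? x')%nat, (y =? y')%nat; simpl; rewrite ?RtoC_mul; ring.
Qed.

Lemma ref_XY_Z_entry u u' x x' y y' i j :
  (u < nU)%nat -> (u' < nU)%nat -> (x < nX)%nat -> (x' < nX)%nat ->
  (y < nY)%nat -> (y' < nY)%nat -> (i < dZ)%nat -> (j < dZ)%nat ->
  ref_XY_Z nU nX nY dX dY dZ Phi pu px py sX sY (idx u x y i) (idx u' x' y' j) =
  if same u u' x x' y y' then Cmul (RtoC (pu u * px u x * py u y))
    (csum nX (fun a => csum nY (fun b => Cmul (RtoC (px u a * py u b)) (W a b i j)))) else C0.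
Proof.
  intros. unfold ref_XY_Z. rewrite refU_entry by assumption. same_block.
  destruct (Req_dec (pu u) 0) as [P0|P0].
  { rewrite P0, !Rmult_0_l, !Cmul_RtoC_0. destruct ((x =? x') && (y =? y'))%nat; reflexivity. }
  rewrite kron_block, rhoXY_entry, rhoZ_entry by assumption.
  destruct (x =? x')%nat, (y =? y')%nat; simpl; rewrite ?RtoC_mul; ring.
Qed.

End Entries.
End CqEntries.

(** * Blocks, Kronecker products and channels *)

Module ComplexMatrices.
Import Lra Lia List Arith Bool.
Import Defs CqEntries.
Local Open Scope R_scope.

Lemma Cconj_mul a b : Cconj (Cmul a b) = Cmul (Cconj a) (Cconj b).
Proof. cring. Qed.

Lemma Cconj_invol a : Cconj (Cconj a) = a.
Proof. cring. Qed.

Lemma csum_conj n f : Cconj (csum n f) = csum n (fun k => Cconj (f k)).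
Proof.
  induction n as [|n IH]; [cring|]. rewrite !csum_S, <- IH. cring.
Qed.

Lemma csum_mulr n c f : csum n (fun k => Cmul (f k) c) = Cmul (csum n f) c.
Proof.
  induction n as [|n IH]; [unfold csum; simpl; ring|]. rewrite !csum_S, IH; ring.
Qed.

Lemma csum_swap a b f :
  csum a (fun i => csum b (fun j => f i j)) = csum b (fun j => csum a (fun i => f i j)).
Proof.
  induction a as [|a IH]; [symmetry; apply csum_0; reflexivity|].
  rewrite csum_S, IH, <- csum_add. apply csum_ext; intros. rewrite csum_S. reflexivity.
Qed.

Definition qform (n : nat) (A : Mat) (v : nat -> C) : C :=
  csum n (fun i => Cmul (Cconj (v i)) (csum n (fun j => Cmul (A i j) (v j)))).

Lemma PSD_ext n A B : (forall i j, (i < n)%nat -> (j < n)%nat -> A i j = B i j) ->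
  PSD n A -> PSD n B.
Proof.
  intros E [H P]. split.
  - intros i j Hi Hj. rewrite <- !E by assumption. apply H; assumption.
  - intro v. specialize (P v). erewrite csum_ext; [exact P|].
    intros i Hi. cbv beta. f_equal. apply csum_ext; intros j Hj. rewrite E by assumption. reflexivity.
Qed.

Definition block (d k : nat) (M : Mat) : Mat := fun i j => M (k * d + i)%nat (k * d + j)%nat.

(** Vectors supported on block [k] test exactly that block. *)
Lemma PSD_block K d k M : (k < K)%nat -> PSD (K * d) M -> PSD d (block d k M).
Proof.
  intros Hk [H P]. split.
  - intros i j Hi Hj. apply H; apply block_lt; assumption.
  - intro v.
    specialize (P (fun a => if (a / d =? k)%nat then v (a mod d)%nat else C0)).
    erewrite csum_ext in P; [|intros; rewrite csum_prod; reflexivity].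
    rewrite csum_prod, (csum_single K k) in P; [|assumption|].
    2:{ intros l _ Hl. apply csum_0; intros i Hi. rewrite div_block by assumption.
        destruct (Nat.eqb_spec l k); [contradiction|]. cring. }
    erewrite csum_ext; [exact P|]. intros i Hi. cbv beta.
    rewrite div_block, mod_block, Nat.eqb_refl by assumption. f_equal.
    rewrite (csum_single K k); [|assumption|].
    + apply csum_ext; intros j Hj. rewrite div_block, mod_block, Nat.eqb_refl by assumption.
      reflexivity.
    + intros l _ Hl. apply csum_0; intros j Hj. rewrite div_block by assumption.
      destruct (Nat.eqb_spec l k); [contradiction|]. ring.
Qed.

Lemma block_Mid d k i j : block d k Mid i j = Mid i j.
Proof.
  unfold block, Mid.
  destruct (Nat.eqb_spec i j), (Nat.eqb_spec (k * d + i) (k * d + j)); reflexivity || lia.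
Qed.

Lemma povm_elem_block K d k M : (k < K)%nat -> povm_elem (K * d) M -> povm_elem d (block d k M).
Proof.
  intros Hk [H1 H2]. split; [apply (PSD_block K); assumption|].
  apply (PSD_ext d (block d k (Msub Mid M))); [|apply (PSD_block K); assumption].
  intros i j _ _. unfold Msub. rewrite <- (block_Mid d k i j). reflexivity.
Qed.

(** Off-diagonal blocks of [P] meet only zero blocks of [M], so a test on a classical-quantum state
    acts through its diagonal blocks alone. *)
Lemma trace_block_diag K d P M :
  (forall k l i j, (k < K)%nat -> (l < K)%nat -> (i < d)%nat -> (j < d)%nat -> k <> l ->
     M (k * d + i)%nat (l * d + j)%nat = C0) ->
  trace (K * d) (Mmul (K * d) P M) =
  csum K (fun k => trace d (Mmul d (block d k P) (block d k M))).
Proof.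
  intro H. unfold trace, Mmul, block. rewrite csum_prod. apply csum_ext; intros k Hk.
  apply csum_ext; intros i Hi. rewrite csum_prod, (csum_single K k); [reflexivity|assumption|].
  intros l Hl Hlk. apply csum_0; intros j Hj. rewrite H by assumption. ring.
Qed.

(** The Gram matrix, for the form [B], of the consecutive blocks of length [n] of [v]. It turns
    positivity of a Kronecker product into that of a trace of two positive matrices. *)
Definition gram (n : nat) (B : Mat) (v : nat -> C) : Mat := fun l k =>
  csum n (fun j => csum n (fun j' =>
    Cmul (Cmul (Cconj (v (k * n + j)%nat)) (B j j')) (v (l * n + j')%nat))).

Lemma qform_kron m n A B v :
  qform (m * n) (kron m n A B) v = trace m (Mmul m A (gram n B v)).
Proof.
  unfold qform, trace, Mmul, gram. rewrite csum_prod. apply csum_ext; intros k Hk.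
  transitivity (csum n (fun j => csum m (fun l => csum n (fun j' =>
    Cmul (A k l) (Cmul (Cmul (Cconj (v (k * n + j)%nat)) (B j j')) (v (l * n + j')%nat)))))).
  - apply csum_ext; intros j Hj. rewrite csum_prod, <- csum_mull.
    apply csum_ext; intros l Hl. rewrite <- csum_mull.
    apply csum_ext; intros j' Hj'. rewrite kron_block by assumption. ring.
  - rewrite csum_swap. apply csum_ext; intros l Hl. rewrite <- csum_mull.
    apply csum_ext; intros j Hj. rewrite <- csum_mull. reflexivity.
Qed.

Lemma PSD_gram m n B v : PSD n B -> PSD m (gram n B v).
Proof.
  intros [H P]. split.
  - intros l k _ _. unfold gram. rewrite csum_conj, csum_swap.
    apply csum_ext; intros j Hj.
    rewrite csum_conj. apply csum_ext; intros j' Hj'.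
    rewrite !Cconj_mul, Cconj_invol, <- (H j' j) by assumption. ring.
  (* The form of the Gram matrix at [z] is that of [B] at the combination of the blocks of [v] with
     coefficients [Cconj (z k)]. *)
  - intro z. specialize (P (fun j => csum m (fun k => Cmul (Cconj (z k)) (v (k * n + j)%nat)))).
    erewrite (f_equal re); [exact P|]. unfold gram.
    transitivity (csum m (fun l => csum m (fun k => csum n (fun j => csum n (fun j' =>
      Cmul (Cmul (Cmul (z k) (Cconj (v (k * n + j)%nat))) (B j j'))
           (Cmul (Cconj (z l)) (v (l * n + j')%nat))))))).
    + apply csum_ext; intros l Hl. rewrite <- csum_mull. apply csum_ext; intros k Hk.
      rewrite <- csum_mulr, <- csum_mull. apply csum_ext; intros j Hj.
      rewrite <- csum_mulr, <- csum_mull. apply csum_ext; intros j' Hj'. ring.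
    + transitivity (csum n (fun j => csum n (fun j' => csum m (fun l => csum m (fun k =>
        Cmul (Cmul (Cmul (z k) (Cconj (v (k * n + j)%nat))) (B j j'))
           (Cmul (Cconj (z l)) (v (l * n + j')%nat))))))).
      * transitivity (csum m (fun l => csum n (fun j => csum n (fun j' => csum m (fun k =>
          Cmul (Cmul (Cmul (z k) (Cconj (v (k * n + j)%nat))) (B j j'))
             (Cmul (Cconj (z l)) (v (l * n + j')%nat))))))).
        { apply csum_ext; intros l Hl. rewrite csum_swap. apply csum_ext; intros j Hj.
          apply csum_swap. }
        rewrite csum_swap. apply csum_ext; intros j Hj. apply csum_swap.
      * apply csum_ext; intros j Hj. rewrite <- csum_mull. apply csum_ext; intros j' Hj'.
        rewrite csum_conj, <- !csum_mull. apply csum_ext; intros l Hl.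
        rewrite csum_mulr, csum_mulr.
        rewrite (csum_ext m (fun k => Cconj _) (fun k => Cmul (z k) (Cconj (v (k * n + j)%nat))))
          by (intros; rewrite Cconj_mul, Cconj_invol; reflexivity).
        ring.
Qed.

Lemma Hermitian_kron m n A B : Hermitian m A -> Hermitian n B -> Hermitian (m * n) (kron m n A B).
Proof.
  intros HA HB i j Hi Hj. unfold kron.
  assert (Hn : n <> 0%nat) by (intros ->; lia).
  rewrite Cconj_mul, <- HA, <- HB; [reflexivity|..];
    try (apply Nat.mod_upper_bound; assumption); apply Nat.Div0.div_lt_upper_bound; lia.
Qed.

Lemma trace_kron m n A B : trace (m * n) (kron m n A B) = Cmul (trace m A) (trace n B).
Proof.
  unfold trace. rewrite csum_prod, <- csum_mulr. apply csum_ext; intros a Ha.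
  rewrite <- csum_mull. apply csum_ext; intros i Hi. apply kron_block; assumption.
Qed.

(** Complete positivity with an ancilla of dimension 1. *)
Lemma channel_PSD din dout F A : is_channel din dout F -> PSD din A -> PSD dout (F A).
Proof.
  intros [[ext _] [cp _]] HA. specialize (cp 1%nat A).
  rewrite !Nat.mul_1_l in cp. apply (PSD_ext dout (ampl din dout F A)); [|apply cp, HA].
  intros i j Hi Hj. unfold ampl.
  rewrite !(Nat.div_small _ dout), !(Nat.mod_small _ dout) by assumption.
  apply ext; try assumption. intros; f_equal; lia.
Qed.

Lemma block_index nU nX nY k : (k < nU * nX * nY)%nat -> exists u x y,
  (u < nU)%nat /\ (x < nX)%nat /\ (y < nY)%nat /\ k = ((u * nX + x) * nY + y)%nat.
Proof.
  intro H. assert (nX <> 0 /\ nY <> 0)%nat as [HX HY] by (split; intros ->; lia).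
  exists (k / nY / nX)%nat, ((k / nY) mod nX)%nat, (k mod nY)%nat.
  repeat split.
  - apply Nat.Div0.div_lt_upper_bound, Nat.Div0.div_lt_upper_bound; lia.
  - apply Nat.mod_upper_bound; assumption.
  - apply Nat.mod_upper_bound; assumption.
  - rewrite (Nat.mul_comm _ nX), <- Nat.div_mod, (Nat.mul_comm _ nY), <- Nat.div_mod by assumption.
    reflexivity.
Qed.

(* The shape shared by the joint state and by the three reference states. *)
Definition cq_blocks (nU nX nY dZ : nat) (tau : nat -> nat -> nat -> Mat) (M : Mat) : Prop :=
  forall u u' x x' y y' i j,
  (u < nU)%nat -> (u' < nU)%nat -> (x < nX)%nat -> (x' < nX)%nat ->
  (y < nY)%nat -> (y' < nY)%nat -> (i < dZ)%nat -> (j < dZ)%nat ->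
  M (idx nX nY dZ u x y i) (idx nX nY dZ u' x' y' j) =
  if ((u =? u') && (x =? x') && (y =? y'))%nat then tau u x y i j else C0.

Lemma trace_cq nU nX nY dZ tau M P : cq_blocks nU nX nY dZ tau M ->
  trace (nU * nX * nY * dZ) (Mmul (nU * nX * nY * dZ) P M) =
  csum nU (fun u => csum nX (fun x => csum nY (fun y =>
    trace dZ (Mmul dZ (block dZ ((u * nX + x) * nY + y) P) (tau u x y))))).
Proof.
  intro H. rewrite trace_block_diag.
  - rewrite !csum_prod. apply csum_ext; intros u Hu. apply csum_ext; intros x Hx.
    apply csum_ext; intros y Hy. unfold trace, Mmul. apply csum_ext; intros i Hi.
    apply csum_ext; intros j Hj. f_equal. unfold block.
    specialize (H u u x x y y j i Hu Hu Hx Hx Hy Hy Hj Hi). unfold idx in H.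
    rewrite !Nat.eqb_refl in H. exact H.
  - intros k l i j Hk Hl Hi Hj Hkl.
    destruct (block_index _ _ _ _ Hk) as (u & x & y & Hu & Hx & Hy & ->).
    destruct (block_index _ _ _ _ Hl) as (u' & x' & y' & Hu' & Hx' & Hy' & ->).
    specialize (H u u' x x' y y' i j Hu Hu' Hx Hx' Hy Hy' Hi Hj). unfold idx in H. rewrite H.
    destruct (Nat.eqb_spec u u'), (Nat.eqb_spec x x'), (Nat.eqb_spec y y'); try reflexivity.
    subst. contradiction.
Qed.

End ComplexMatrices.

(** * Logarithms and choice of the constants *)

Module Numerics.
Import Lra Lia Defs.
Local Open Scope R_scope.

Lemma ln2_gt0 : 0 < ln 2.
Proof. rewrite <- ln_1. apply ln_increasing; lra. Qed.

Lemma log2_le x y : 0 < x -> x <= y -> log2 x <= log2 y.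
Proof.
  intros Hx Hxy. apply Rmult_le_compat_r.
  - left. apply Rinv_0_lt_compat, ln2_gt0.
  - destruct Hxy as [Hxy| <-]; [left; apply ln_increasing; assumption | right; reflexivity].
Qed.

Lemma log2_mul x y : 0 < x -> 0 < y -> log2 (x * y) = log2 x + log2 y.
Proof. intros. unfold log2. rewrite ln_mult by assumption. field. pose proof ln2_gt0. lra. Qed.

(** The rate loss [2 + log2 (/ eps)] is exactly what makes the expected number of false acceptances
    at most [eps / 4]. *)
Lemma code_size_bound m b eps : 0 < m -> 0 < b -> 0 < eps ->
  log2 m <= - log2 b - 2 - log2 (/ eps) -> m * b <= eps / 4.
Proof.
  intros Hm Hb He H.
  assert (L4 : log2 4 = 2).
  { replace 4 with (2 * 2) by ring. rewrite log2_mul by lra. unfold log2. field.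
    pose proof ln2_gt0; lra. }
  assert (Li : log2 (/ eps) = - log2 eps).
  { unfold log2. rewrite ln_Rinv by assumption. field. pose proof ln2_gt0; lra. }
  assert (L : log2 (4 * (m * b)) <= log2 eps).
  { rewrite !log2_mul by nra. lra. }
  destruct (Rle_or_lt (4 * (m * b)) eps) as [|C]; [lra|].
  exfalso. apply ln_increasing in C; [|assumption].
  unfold log2 in L. apply Rmult_le_reg_r in L; [lra|]. apply Rinv_0_lt_compat, ln2_gt0.
Qed.

(** The square is [eps^(1/3)], the order of the final error; [eps] divided by that square is then
    only [eps^(2/3)]. *)
Definition amplitude eps := Rpower eps (1 / 6).
(** Chosen so that the regularisation terms of all wrong guesses together contribute [eps]. *)
Definition slack eps m1 m2 := eps / (16 * (m1 + m2 + m1 * m2)).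

Lemma amplitude_bounds eps : 0 < eps < 1 -> 0 < amplitude eps <= 1.
Proof.
  intros H. split; [apply exp_pos|]. unfold amplitude, Rpower.
  rewrite <- exp_0 at 2. left. apply exp_increasing.
  assert (ln eps < 0) by (rewrite <- ln_1; apply ln_increasing; lra). lra.
Qed.

Lemma slack_gt0 eps m1 m2 : 0 < eps < 1 -> 1 <= m1 -> 1 <= m2 -> 0 < slack eps m1 m2.
Proof. intros. apply Rdiv_lt_0_compat; nra. Qed.

Lemma error_bound eps m1 m2 b1 b2 b3 : 0 < eps < 1 -> 1 <= m1 -> 1 <= m2 ->
  m1 * b1 <= eps / 4 -> m2 * b2 <= eps / 4 -> m1 * m2 * b3 <= eps / 4 ->
  let s := slack eps m1 m2 in let d2 := amplitude eps ^ 2 in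
  144 * eps / d2 + 16 * (m1 * (b1 + s) + m2 * (b2 + s) + m1 * (m2 * (b3 + s))) + 4 * d2
  <= 2 ^ 135 * Rpower eps (1 / 3).
Proof.
  intros He H1 H2 B1 B2 B3 s d2.
  pose proof (amplitude_bounds eps He) as [A0 A1].
  assert (T : Rpower eps (1 / 3) = d2).
  { unfold d2, amplitude. simpl. rewrite Rmult_1_r, <- Rpower_plus. f_equal. field. }
  assert (T3 : eps = d2 * d2 * d2).
  { rewrite <- T. transitivity (Rpower eps (1 / 3 + 1 / 3 + 1 / 3)).
    - replace (1 / 3 + 1 / 3 + 1 / 3) with 1 by field. rewrite Rpower_1; lra.
    - rewrite !Rpower_plus. reflexivity. }
  assert (D : 0 < d2 <= 1) by (unfold d2; simpl; nra).
  assert (S : 16 * (m1 + m2 + m1 * m2) * s = eps).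
  { unfold s, slack. field. nra. }
  assert (Q : 144 * eps / d2 = 144 * (d2 * d2)) by (rewrite T3; field; lra).
  rewrite T, Q.
  (* As [eps = d2^3], each contribution is at most a multiple of [d2]; the multiples
     [144 + 12 + 1 + 4] sum to less than [2 ^ 8]. *)
  assert (P : 2 ^ 8 <= 2 ^ 135) by (apply Rle_pow; [lra|repeat constructor]).
  assert (P8 : 2 ^ 8 = 256) by (simpl; ring).
  generalize dependent (2 ^ 135). intros big P. rewrite P8 in P.
  clearbody s d2. clear T Q.
  assert (eps <= d2) by nra. assert (d2 * d2 <= d2) by nra.
  assert (256 * d2 <= big * d2) by nra.
  nra.
Qed.

End Numerics.

(** * Complex matrices as real matrices of doubled size *)

Module Realification.
Import ssreflect ssrfun ssrbool eqtype ssrnat seq choice fintype finfun bigop.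
Import order ssralg ssrnum zmodp matrix mxalgebra ring lra.
Import Rstruct.
Import Defs CqEntries ComplexMatrices Numerics RealForms MacDecoder OptimalTest.
Set Implicit Arguments.
Unset Strict Implicit.
Unset Printing Implicit Defensive.
Import Order.TTheory GRing.Theory Num.Theory.
Delimit Scope R_scope with coqR.
Local Open Scope ring_scope.

Lemma re_csum n f : re (csum n f) = \sum_(i < n) re (f i).
Proof.
elim: n => [|n IH]; first by rewrite big_ord0.
by rewrite csum_S big_ord_recr /= IH.
Qed.

Lemma im_csum n f : im (csum n f) = \sum_(i < n) im (f i).
Proof.
elim: n => [|n IH]; first by rewrite big_ord0.
by rewrite csum_S big_ord_recr /= IH.
Qed.

Lemma rsumE n f : rsum n f = \sum_(i < n) f i.
Proof.
elim: n => [|n IH]; first by rewrite big_ord0.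
by rewrite rsum_S big_ord_recr /= IH.
Qed.

Section Rl.
Variable d : nat.
Implicit Types (A P : Mat) (L : 'M[R]_(d + d)).

Definition reM A : 'M[R]_d := \matrix_(i, j) re (A i j).
Definition imM A : 'M[R]_d := \matrix_(i, j) im (A i j).

(* The real form of a complex matrix, acting on [(Re v, Im v)]; [rlh] halves it so that the trace of a state is 1. *)
Definition rl A : 'M[R]_(d + d) := block_mx (reM A) (- imM A) (imM A) (reM A).
Definition rlh A := 2^-1 *: rl A.

(** A [Mat] has entries at all natural indices; outside the range the value is 0. *)
Definition ent m (u : 'M[R]_(d, m)) (i j : nat) : R :=
  if (insub i, insub j) is (Some k, Some l) then u k l else 0.

Lemma entE m (u : 'M[R]_(d, m)) (i : 'I_d) (j : 'I_m) : ent u i j = u i j.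
Proof. by rewrite /ent !valK. Qed.

Lemma rl_ext A P : (forall i j, Peano.lt i d -> Peano.lt j d -> A i j = P i j) -> rl A = rl P.
Proof.
move=> H; congr block_mx; try congr (- _);
  by apply/matrixP => i j; rewrite !mxE H //; apply/ssrnat.ltP.
Qed.

Lemma rl_inj A P : rl A = rl P ->
  forall i j, Peano.lt i d -> Peano.lt j d -> A i j = P i j.
Proof.
move=> /eq_block_mx [eR _ eI _] i j /ssrnat.ltP hi /ssrnat.ltP hj; apply: C_ext.
  by move/matrixP: eR => /(_ (Ordinal hi) (Ordinal hj)); rewrite !mxE.
by move/matrixP: eI => /(_ (Ordinal hi) (Ordinal hj)); rewrite !mxE.
Qed.

Lemma qform_rl A (v : nat -> C) (a b : 'cV[R]_d) :
  (forall i : 'I_d, v i = mkC (a i 0) (b i 0)) ->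
  re (qform d A v) = dot (col_mx a b) (rl A *m col_mx a b).
Proof.
move=> vE; rewrite mul_block_col /dot tr_col_mx mul_row_col mxE -!/(dot _ _) !dotE -big_split.
rewrite re_csum; apply: eq_bigr => i _ /=.
rewrite re_csum im_csum vE /= !mxE.
rewrite RminusE !RmultE RoppE mulNr opprK; congr (_ * _ + _ * _).
  by rewrite -big_split; apply: eq_bigr => j _ /=; rewrite vE !mxE /= mulNr.
by rewrite -big_split; apply: eq_bigr => j _ /=; rewrite vE !mxE /= RplusE addrC.
Qed.

Lemma psd_rl A : PSD d A -> psd (rl A).
Proof.
move=> [hA pA].
have rA (i j : 'I_d) : re (A j i) = re (A i j) by rewrite hA //; apply/ssrnat.ltP.
have iA (i j : 'I_d) : im (A j i) = - im (A i j) by rewrite hA //; apply/ssrnat.ltP.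
split.
  rewrite tr_block_mx; congr block_mx; apply/matrixP => i j; rewrite !mxE.
  - exact: rA.
  - exact: iA.
  - by rewrite iA opprK.
  - exact: rA.
move=> w; pose a := usubmx w; pose b := dsubmx w.
have := pA (fun i => mkC (ent a i 0%N) (ent b i 0%N)).
rewrite (@qform_rl A _ a b) ?vsubmxK => [/RleP // | i].
by rewrite (entE a i 0) (entE b i 0).
Qed.

Lemma PSD_rl A : psd (rl A) -> PSD d A.
Proof.
move=> [sA pA]; split.
  move=> i j /ssrnat.ltP hi /ssrnat.ltP hj.
  move: sA; rewrite tr_block_mx => /eq_block_mx [rA iA _ _].
  move/matrixP: rA => /(_ (Ordinal hj) (Ordinal hi)).
  move/matrixP: iA => /(_ (Ordinal hj) (Ordinal hi)).
  by rewrite !mxE /= => eI eR; apply: C_ext.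
move=> v; pose a : 'cV[R]_d := \col_i re (v i); pose b : 'cV[R]_d := \col_i im (v i).
apply/RleP; change (0 <= re (qform d A v)); rewrite (@qform_rl A _ a b) => [|i].
  exact: pA.
by rewrite !mxE; case: (v i).
Qed.

Lemma trRe_rl P A : trRe d P A = \tr (rl P *m rlh A).
Proof.
rewrite /rlh /rl -scalemxAr mxtraceZ mulmx_block mxtrace_block !mxtraceD mulNmx mulmxN.
have -> : \tr (- (imM P *m imM A)) = - \tr (imM P *m imM A) by rewrite linearN.
have -> : trRe d P A = \tr (reM P *m reM A) - \tr (imM P *m imM A); last by lra.
rewrite /trRe /trace /Mmul re_csum /mxtrace -sumrB; apply: eq_bigr => i _.
by rewrite re_csum !mxE -sumrB; apply: eq_bigr => j _; rewrite !mxE.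
Qed.

Lemma mxtrace_rlh A : \tr (rlh A) = re (trace d A).
Proof.
rewrite mxtraceZ mxtrace_block re_csum; have -> : \tr (reM A) = \sum_(i < d) re (A i i).
  by apply: eq_bigr => i _; rewrite mxE.
by lra.
Qed.

Lemma rl_sub A P : rl (Msub A P) = rl A - rl P.
Proof.
rewrite /rl opp_block_mx add_block_mx.
by congr block_mx; apply/matrixP => i j; rewrite !mxE /= ?RplusE ?RoppE // opprD opprK.
Qed.

Lemma rl_Mid : rl Mid = 1%:M.
Proof.
have -> : rl Mid = block_mx 1%:M (- 0) 0 1%:M; last by rewrite oppr0 -scalar_mx_block.
rewrite /rl; have -> : imM Mid = 0.
  by apply/matrixP => i j; rewrite !mxE /Mid; case: Nat.eqb.
suff -> : reM Mid = 1%:M by [].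
apply/matrixP => i j; rewrite !mxE /Mid; case: (Nat.eqb_spec i j) => [/ord_inj -> | H] /=.
  by rewrite eqxx.
by case: (eqVneq i j) => // ij; case: H; rewrite ij.
Qed.

Lemma effect_rl P : povm_elem d P -> effect (rl P).
Proof.
by move=> [/psd_rl h1 /psd_rl h2]; split => //; rewrite -rl_Mid -rl_sub.
Qed.

(** Multiplication by the imaginary unit on pairs [(Re v, Im v)]; real forms of complex matrices
    commute with it. *)
Let J : 'M[R]_(d + d) := block_mx 0 (- 1%:M) 1%:M 0.

Let JJ : J^T *m J = 1%:M.
Proof.
rewrite tr_block_mx !trmx0 linearN /= !trmx1 mulmx_block.
rewrite !(mulmx0, mul0mx, mulmx1, mul1mx, mulNmx, mulmxN, opprK, oppr0, addr0, add0r).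
by rewrite -scalar_mx_block.
Qed.

Let rlJ A : J *m rl A = rl A *m J.
Proof.
by rewrite !mulmx_block !(mulmx0, mul0mx, mulmx1, mul1mx, mulNmx, mulmxN, opprK, addr0, add0r).
Qed.

(* Averaging over [J] projects a real matrix onto those that come from a complex one. *)
Definition cx L : Mat := fun i j =>
  mkC (ent (2^-1 *: (ulsubmx L + drsubmx L)) i j) (ent (2^-1 *: (dlsubmx L - ursubmx L)) i j).

Lemma rl_cx L : rl (cx L) = 2^-1 *: (L + J^T *m L *m J).
Proof.
rewrite -{2 3}[L]submxK tr_block_mx !trmx0 linearN /= !trmx1.
rewrite !mulmx_block !(mulmx0, mul0mx, mulmxN, mulNmx, mul1mx, mulmx1, addr0, add0r, opprK).
rewrite add_block_mx scale_block_mx /rl.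
by congr block_mx; apply/matrixP => i j; rewrite !mxE /= ?entE !mxE; lra.
Qed.

Lemma rl_cx_sum (I : finType) (F : I -> 'M[R]_(d + d)) :
  rl (cx (\sum_i F i)) = \sum_i rl (cx (F i)).
Proof.
rewrite rl_cx mulmx_sumr mulmx_suml -big_split scaler_sumr /=.
by apply: eq_bigr => i _; rewrite rl_cx.
Qed.

Lemma rl_cx1 : rl (cx 1%:M) = 1%:M.
Proof. by rewrite rl_cx mulmx1 JJ; apply/matrixP => i j; rewrite !mxE; lra. Qed.

Lemma psd_cx L : psd L -> PSD d (cx L).
Proof.
move=> pL; apply: PSD_rl; rewrite rl_cx; apply: psdZ; first by rewrite invr_ge0.
by apply: psdD => //; apply: psd_conj.
Qed.

(** Since [rl A] commutes with [J], averaging the effect over [J] leaves its trace against a state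
    unchanged. *)
Lemma trRe_cx L A : trRe d (cx L) A = \tr (L *m rlh A).
Proof.
have JJ' : J *m J^T = 1%:M by apply: mulmx1C; exact: JJ.
rewrite trRe_rl rl_cx /rlh -!scalemxAl -!scalemxAr !mxtraceZ mulmxDl mxtraceD.
have -> : \tr (J^T *m L *m J *m rl A) = \tr (L *m rl A).
  by rewrite -!mulmxA rlJ mxtrace_mulC -!mulmxA JJ' mulmx1.
by lra.
Qed.

Lemma povm_elem_cx L : effect L -> povm_elem d (cx L).
Proof.
move=> [p1 p2]; split; first exact: psd_cx.
apply: PSD_rl; rewrite rl_sub rl_Mid.
suff -> : 1%:M - rl (cx L) = rl (cx (1%:M - L)) by apply: psd_rl; apply: psd_cx.
rewrite !rl_cx mulmxBr mulmxBl mulmx1 JJ.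
by apply/matrixP => i j; rewrite !mxE; lra.
Qed.

End Rl.

Lemma mxtrace_PSD_ge0 d A B : PSD d A -> PSD d B -> (0 <= trRe d A B)%coqR.
Proof.
move=> pA pB; apply/RleP; rewrite trRe_rl; apply: mxtrace_psd_ge0.
  by case: (psd_rl pA).
by apply: psdZ; [rewrite invr_ge0 | exact: psd_rl].
Qed.

Lemma rlh_scale d a B : rlh d (fun i j => Cmul (RtoC a) (B i j)) = a *: rlh d B.
Proof.
rewrite /rlh; suff -> : rl d (fun i j => Cmul (RtoC a) (B i j)) = a *: rl d B.
  by rewrite !scalerA mulrC.
rewrite /rl scale_block_mx scalerN; congr block_mx; try congr (- _);
  by apply/matrixP => i j; rewrite !mxE /= ?RmultE ?RminusE ?RplusE mul0r ?subr0 ?addr0.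
Qed.

Lemma rlh_csum d n (F : nat -> Mat) :
  rlh d (fun i j => csum n (fun k => F k i j)) = \sum_(k < n) rlh d (F k).
Proof.
rewrite /rlh -scaler_sumr; congr (_ *: _); apply/matrixP => i j; rewrite summxE.
by rewrite -(splitK i) -(splitK j); case: (split i) => i'; case: (split j) => j' /=;
  rewrite ?(block_mxEul, block_mxEur, block_mxEdl, block_mxEdr) !mxE ?re_csum ?im_csum -?sumrN;
  apply: eq_bigr => k _; rewrite ?(block_mxEul, block_mxEur, block_mxEdl, block_mxEdr) !mxE.
Qed.

Lemma PSD_kron m n A B : PSD m A -> PSD n B -> PSD (m * n) (kron m n A B).
Proof.
move=> pA pB; split; first by apply: Hermitian_kron; [case: pA | case: pB].
move=> v; change (0 <= re (qform (m * n) (kron m n A B) v))%coqR.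
by rewrite qform_kron; apply: mxtrace_PSD_ge0 => //; apply: PSD_gram.
Qed.

(** An optimal real effect is made complex by [cx], and complex competitors are compared with it
    through [rl]. This shows that some value satisfies [is_DH], so the choice operator in [DH]
    returns such a value, with a test [Q] attaining it. *)
Lemma DH_attained n alpha beta eps : trRe n Mid alpha = 1%coqR -> (0 <= eps)%coqR ->
  (forall P, povm_elem n P -> (trRe n P alpha >= 1 - eps)%coqR -> (trRe n P beta > 0)%coqR) ->
  exists P, [/\ povm_elem n P, (trRe n P alpha >= 1 - eps)%coqR,
    (trRe n P beta > 0)%coqR & DH n alpha beta eps = (- log2 (trRe n P beta))%coqR].
Proof.
move=> tra eps0 pos.
have [|P [eP cP] minP] := @optimal_test _ _ (rlh n alpha) (rlh n beta) (1 - eps).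
  exists 1%:M; first exact: effect1.
  by rewrite -rl_Mid -trRe_rl tra lerBlDr lerDl; apply/RleP.
have cP' : (trRe n (cx P) alpha >= 1 - eps)%coqR by rewrite trRe_cx; apply/Rle_ge/RleP.
have pP := povm_elem_cx eP.
have D : is_DH n alpha beta eps (- log2 (trRe n (cx P) beta)).
  split; first by exists (cx P); split => //; split => //; split => //; exact: pos.
  move=> P' pP' cP'' b0; apply: Ropp_le_contravar; apply: log2_le; first exact: pos.
  rewrite trRe_cx trRe_rl; apply/RleP; apply: minP; first exact: effect_rl.
  by rewrite -trRe_rl; apply/RleP; apply: Rge_le.
have [[Q [pQ [cQ [bQ dQ]]]] _] := ClassicalEpsilon.epsilon_spec (inhabits 0%coqR) (fun d => is_DH n alpha beta eps d)
  (ex_intro _ _ D).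
by exists Q; split.
Qed.

End Realification.

(** * Tests on the classical-quantum states and assembly of the code *)

Module MacCode.
Import ssreflect ssrfun ssrbool eqtype ssrnat seq choice fintype finfun bigop.
Import order ssralg ssrnum zmodp matrix mxalgebra ring lra.
Import Rstruct.
Import Defs CqEntries ComplexMatrices Numerics RealForms MacDecoder CodeExistence Realification.
Set Implicit Arguments.
Unset Strict Implicit.
Unset Printing Implicit Defensive.
Import Order.TTheory GRing.Theory Num.Theory.
Delimit Scope R_scope with coqR.
Local Open Scope ring_scope.

Lemma psumr_gt0 (I : finType) (F : I -> R) i : (forall j, 0 <= F j) -> 0 < F i -> 0 < \sum_j F j.
Proof.
by move=> F0 Fi; rewrite (bigD1 i) //= ltr_pwDl // sumr_ge0.
Qed.

Lemma sumr_gt0_exists (I : finType) (F : I -> R) : 0 < \sum_j F j -> exists i, 0 < F i.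
Proof.
move=> S; apply/existsP; apply: contraT; rewrite negb_exists => /forallP H.
by have : \sum_j F j <= 0 by [apply: sumr_le0 => i _; rewrite leNgt H]; rewrite leNgt S.
Qed.

Section Main.
Variables (dX dY dZ : nat) (Phi : Mat -> Mat) (nU nX nY : nat) (sX sY : nat -> Mat).
Variables (pu : nat -> R) (px py : nat -> nat -> R).
Hypothesis HPhi : is_channel (Nat.mul dX dY) dZ Phi.
Hypothesis HsX : forall x, Peano.lt x nX -> density dX (sX x).
Hypothesis HsY : forall y, Peano.lt y nY -> density dY (sY y).
Hypothesis Hpu0 : forall u, Peano.lt u nU -> (0 <= pu u)%coqR.
Hypothesis Hpu1 : rsum nU pu = 1%coqR.
Hypothesis Hpx0 : forall u x, Peano.lt u nU -> Peano.lt x nX -> (0 <= px u x)%coqR.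
Hypothesis Hpx1 : forall u, Peano.lt u nU -> rsum nX (px u) = 1%coqR.
Hypothesis Hpy0 : forall u y, Peano.lt u nU -> Peano.lt y nY -> (0 <= py u y)%coqR.
Hypothesis Hpy1 : forall u, Peano.lt u nU -> rsum nY (py u) = 1%coqR.

Let W x y := Phi (kron dX dY (sX x) (sY y)).
Let N := dimUXYZ nU nX nY dZ.

Lemma density_output x y : Peano.lt x nX -> Peano.lt y nY -> density dZ (W x y).
Proof.
move=> /HsX [pX tX] /HsY [pY tY]; split.
  by apply: (channel_PSD _ _ _ _ HPhi); apply: PSD_kron.
case: HPhi => _ [_ tr]; rewrite /W tr trace_kron tX tY.
by cring.
Qed.

Let ltn (n : nat) (i : 'I_n) : Peano.lt i n. Proof. exact/ssrnat.ltP. Qed.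

Let A (x : 'I_nX) (y : 'I_nY) := rlh dZ (W x y).

Let psdA x y : psd (A x y).
Proof.
apply: psdZ; first by rewrite invr_ge0.
by apply: psd_rl; case: (density_output (ltn x) (ltn y)).
Qed.

Let trA x y : \tr (A x y) = 1.
Proof. by rewrite mxtrace_rlh; case: (density_output (ltn x) (ltn y)) => _ ->. Qed.

Let pu0 (u : 'I_nU) : 0 <= pu u. Proof. by apply/RleP/Hpu0. Qed.
Let px0 (u : 'I_nU) (x : 'I_nX) : 0 <= px u x. Proof. by apply/RleP/Hpx0. Qed.
Let py0 (u : 'I_nU) (y : 'I_nY) : 0 <= py u y. Proof. by apply/RleP/Hpy0. Qed.
Let pu1 : \sum_(u < nU) pu u = 1. Proof. by rewrite -rsumE. Qed.
Let px1 (u : 'I_nU) : \sum_(x < nX) px u x = 1. Proof. by rewrite -rsumE Hpx1. Qed.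
Let py1 (u : 'I_nU) : \sum_(y < nY) py u y = 1. Proof. by rewrite -rsumE Hpy1. Qed.

Definition test (P : Mat) (u : 'I_nU) (x : 'I_nX) (y : 'I_nY) : 'M[R]_(dZ + dZ) :=
  rl dZ (block dZ (Nat.add (Nat.mul (Nat.add (Nat.mul u nX) x) nY) y) P).

Lemma effect_test P u x y : povm_elem N P -> effect (test P u x y).
Proof.
by move=> pP; apply: effect_rl; apply: (povm_elem_block (nU * nX * nY)) pP; do 2 (apply: block_lt => //).
Qed.

Lemma trRe_cq tau M P : cq_blocks nU nX nY dZ tau M ->
  trRe N P M = \sum_u \sum_x \sum_y \tr (test P u x y *m rlh dZ (tau u x y)).
Proof.
move=> H; rewrite /trRe /N /dimUXYZ (trace_cq _ _ _ _ _ _ _ H) re_csum; apply: eq_bigr => u _.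
rewrite re_csum; apply: eq_bigr => x _; rewrite re_csum; apply: eq_bigr => y _.
exact: trRe_rl.
Qed.

Let rho := rhoUXYZ nU nX nY dX dY dZ Phi pu px py sX sY.
Let ref1 := ref_X_YZ nU nX nY dX dY dZ Phi pu px py sX sY.
Let ref2 := ref_Y_XZ nU nX nY dX dY dZ Phi pu px py sX sY.
Let ref3 := ref_XY_Z nU nX nY dX dY dZ Phi pu px py sX sY.

Let W_trace x y : Peano.lt x nX -> Peano.lt y nY -> trace dZ (W x y) = C1.
Proof. by move=> hx hy; case: (density_output hx hy). Qed.

Lemma trRe_rho P : trRe N P rho =
  \sum_(u < nU) pu u * \sum_(x < nX) px u x * \sum_(y < nY) py u y * \tr (test P u x y *m A x y).
Proof.
rewrite (@trRe_cq (fun u x y i j => Cmul (RtoC (pu u * px u x * py u y)%coqR) (W x y i j))); last first.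
  by move=> *; apply: rho_entry.
apply: eq_bigr => u _; rewrite mulr_sumr; apply: eq_bigr => x _; rewrite !mulr_sumr.
apply: eq_bigr => y _; rewrite rlh_scale -scalemxAr mxtraceZ !RmultE.
by rewrite !mulrA.
Qed.

(** The tested symbol [x] and the transmitted symbol [a] are independent given [u], as for a wrong
    first message. The order of the sums is the one expected by [random_mac_code]. *)
Lemma trRe_ref1 P : trRe N P ref1 =
  \sum_(u < nU) pu u * \sum_(x < nX) px u x * \sum_(a < nX) px u a * \sum_(y < nY) py u y * \tr (test P u x y *m A a y).
Proof.
rewrite (@trRe_cq (fun u x y i j => Cmul (RtoC (pu u * px u x * py u y)%coqR)
  (csum nX (fun a => Cmul (RtoC (px u a)) (W a y i j))))); last first.
  by move=> *; apply: ref_X_YZ_entry.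
apply: eq_bigr => u _; rewrite mulr_sumr; apply: eq_bigr => x _.
under [in RHS]eq_bigr do rewrite mulr_sumr.
rewrite [X in _ = _ * (_ * X)]exchange_big !mulr_sumr /=; apply: eq_bigr => y _.
rewrite (rlh_scale _ _ (fun i j => csum _ _)).
rewrite (rlh_csum _ _ (fun a i j => Cmul (RtoC (px u a)) (W a y i j))).
rewrite -scalemxAr mxtraceZ mulmx_sumr raddf_sum !mulr_sumr /=; apply: eq_bigr => a _.
by rewrite rlh_scale -scalemxAr mxtraceZ !RmultE -/(A a y); ring.
Qed.

Lemma trRe_ref2 P : trRe N P ref2 =
  \sum_(u < nU) pu u * \sum_(x < nX) px u x * \sum_(y < nY) py u y * \sum_(b < nY) py u b * \tr (test P u x y *m A x b).
Proof.
rewrite (@trRe_cq (fun u x y i j => Cmul (RtoC (pu u * px u x * py u y)%coqR)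
  (csum nY (fun b => Cmul (RtoC (py u b)) (W x b i j))))); last first.
  by move=> *; apply: ref_Y_XZ_entry.
apply: eq_bigr => u _; rewrite mulr_sumr; apply: eq_bigr => x _.
rewrite !mulr_sumr; apply: eq_bigr => y _.
rewrite (rlh_scale _ _ (fun i j => csum _ _)).
rewrite (rlh_csum _ _ (fun b i j => Cmul (RtoC (py u b)) (W x b i j))).
rewrite -scalemxAr mxtraceZ mulmx_sumr raddf_sum !mulr_sumr /=; apply: eq_bigr => b _.
by rewrite rlh_scale -scalemxAr mxtraceZ !RmultE -/(A x b); ring.
Qed.

Lemma trRe_ref3 P : trRe N P ref3 =
  \sum_(u < nU) pu u * \sum_(x < nX) px u x * \sum_(a < nX) px u a * \sum_(y < nY) py u y * \sum_(b < nY) py u b *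
    \tr (test P u x y *m A a b).
Proof.
rewrite (@trRe_cq (fun u x y i j => Cmul (RtoC (pu u * px u x * py u y)%coqR)
  (csum nX (fun a => csum nY (fun b => Cmul (RtoC (px u a * py u b)%coqR) (W a b i j)))))); last first.
  by move=> *; apply: ref_XY_Z_entry.
apply: eq_bigr => u _; rewrite mulr_sumr; apply: eq_bigr => x _.
under [in RHS]eq_bigr do rewrite mulr_sumr.
rewrite [X in _ = _ * (_ * X)]exchange_big !mulr_sumr /=; apply: eq_bigr => y _.
rewrite (rlh_scale _ _ (fun i j => csum _ _)).
rewrite (rlh_csum _ _ (fun a i j => csum nY (fun b => Cmul (RtoC (px u a * py u b)%coqR) (W a b i j)))).
rewrite -scalemxAr mxtraceZ mulmx_sumr raddf_sum !mulr_sumr /=; apply: eq_bigr => a _.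
rewrite (rlh_csum _ _ (fun b i j => Cmul (RtoC (px u a * py u b)%coqR) (W a b i j))).
rewrite mulmx_sumr raddf_sum !mulr_sumr /=; apply: eq_bigr => b _.
by rewrite rlh_scale -scalemxAr mxtraceZ !RmultE -/(A a b); ring.
Qed.

Lemma trRe_Mid_rho : trRe N Mid rho = 1.
Proof.
rewrite trRe_rho -[RHS]pu1; apply: eq_bigr => u _; rewrite -[RHS]mulr1; congr (_ * _).
rewrite -(px1 u); apply: eq_bigr => x _; rewrite -[RHS]mulr1; congr (_ * _).
rewrite -(py1 u); apply: eq_bigr => y _; rewrite -[RHS]mulr1; congr (_ * _).
rewrite /test (rl_ext (P := Mid)) ?rl_Mid ?mul1mx ?trA // => i j _ _.
exact: block_Mid.
Qed.

Section Positive.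
Variables (eps : R) (P : Mat).
Hypothesis eps1 : (eps < 1)%coqR.
Hypothesis pP : povm_elem N P.
Hypothesis hit : (trRe N P rho >= 1 - eps)%coqR.

Let t0 u x y a b : 0 <= \tr (test P u x y *m A a b).
Proof. by apply: mxtrace_psd_ge0 => // v; case: (effect_test u x y pP) => [[_ ->]]. Qed.

(** Because [eps < 1], the acceptance probability on the joint state is strictly positive, hence so
    is one of its terms. *)
Let t_ex : exists u x y, [/\ 0 < pu (u : 'I_nU), 0 < px u (x : 'I_nX), 0 < py u (y : 'I_nY) &
  0 < \tr (test P u x y *m A x y)].
Proof.
have : 0 < trRe N P rho.
  by apply/RltP; apply: Rlt_le_trans (Rge_le _ _ hit); apply: Rlt_Rminus.
have split_gt0 (a b : R) : 0 <= a -> 0 <= b -> 0 < a * b -> 0 < a /\ 0 < b.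
  by rewrite !le0r => /orP [/eqP -> | -> ] /orP [/eqP -> | ->]; rewrite ?mul0r ?mulr0 ?ltxx.
rewrite trRe_rho => /sumr_gt0_exists [u] /split_gt0 [] //.
  by do 2 (apply: sumr_ge0 => ? _; rewrite mulr_ge0 //).
move=> hu /sumr_gt0_exists [x] /split_gt0 [] //.
  by apply: sumr_ge0 => ? _; rewrite mulr_ge0.
move=> hx /sumr_gt0_exists [y] /split_gt0 [] // hy ht.
by exists u, x, y.
Qed.

Ltac sum_ge0 := repeat first [exact: t0 | apply: mulr_ge0 => // | apply: sumr_ge0 => ? _].

(** The sum contains the term in which the resampled symbol equals the tested one, and [t_ex] makes
    it positive. Thus no admissible test has an infinite logarithm, as [DH_attained] requires. *)
Lemma ref1_gt0 : (trRe N P ref1 > 0)%coqR.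
Proof.
apply/RltP; have [u [x [y [hu hx hy ht]]]] := t_ex.
rewrite trRe_ref1; apply: (psumr_gt0 (i := u)) => [j|]; first by sum_ge0.
apply: mulr_gt0 => //; apply: (psumr_gt0 (i := x)) => [j|]; first by sum_ge0.
apply: mulr_gt0 => //; apply: (psumr_gt0 (i := x)) => [j|]; first by sum_ge0.
apply: mulr_gt0 => //; apply: (psumr_gt0 (i := y)) => [j|]; first by sum_ge0.
exact: mulr_gt0.
Qed.

Lemma ref2_gt0 : (trRe N P ref2 > 0)%coqR.
Proof.
apply/RltP; have [u [x [y [hu hx hy ht]]]] := t_ex.
rewrite trRe_ref2; apply: (psumr_gt0 (i := u)) => [j|]; first by sum_ge0.
apply: mulr_gt0 => //; apply: (psumr_gt0 (i := x)) => [j|]; first by sum_ge0.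
apply: mulr_gt0 => //; apply: (psumr_gt0 (i := y)) => [j|]; first by sum_ge0.
apply: mulr_gt0 => //; apply: (psumr_gt0 (i := y)) => [j|]; first by sum_ge0.
exact: mulr_gt0.
Qed.

Lemma ref3_gt0 : (trRe N P ref3 > 0)%coqR.
Proof.
apply/RltP; have [u [x [y [hu hx hy ht]]]] := t_ex.
rewrite trRe_ref3; apply: (psumr_gt0 (i := u)) => [j|]; first by sum_ge0.
apply: mulr_gt0 => //; apply: (psumr_gt0 (i := x)) => [j|]; first by sum_ge0.
apply: mulr_gt0 => //; apply: (psumr_gt0 (i := x)) => [j|]; first by sum_ge0.
apply: mulr_gt0 => //; apply: (psumr_gt0 (i := y)) => [j|]; first by sum_ge0.
apply: mulr_gt0 => //; apply: (psumr_gt0 (i := y)) => [j|]; first by sum_ge0.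
exact: mulr_gt0.
Qed.

End Positive.

Lemma mac_code_exists (eps : R) (M1 M2 : nat) :
  (0 < eps < 1)%coqR -> Peano.le 1 M1 -> Peano.le 1 M2 ->
  (log2 (INR M1) <=
    IH_X_YZ nU nX nY dX dY dZ Phi pu px py sX sY eps - 2 - log2 (/ eps))%coqR ->
  (log2 (INR M2) <=
    IH_Y_XZ nU nX nY dX dY dZ Phi pu px py sX sY eps - 2 - log2 (/ eps))%coqR ->
  (log2 (INR M1) + log2 (INR M2) <=
    IH_XY_Z nU nX nY dX dY dZ Phi pu px py sX sY eps - 2 - log2 (/ eps))%coqR ->
  exists (alpha beta : nat -> Mat) (Lam : nat -> nat -> Mat),
    MAC_code dX dY dZ Phi M1 M2 (2 ^ 135 * Rpower eps (1 / 3))%coqR alpha beta Lam.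
Proof.
move=> Heps HM1 HM2 HR1 HR2 HR12; have [eps0 eps1] := Heps.
have eps0' := Rlt_le _ _ eps0.
have [P1 [pP1 h1 b1 D1]] := DH_attained trRe_Mid_rho eps0' (fun P pP h => ref1_gt0 eps1 pP h).
have [P2 [pP2 h2 b2 D2]] := DH_attained trRe_Mid_rho eps0' (fun P pP h => ref2_gt0 eps1 pP h).
have [P3 [pP3 h3 b3 D3]] := DH_attained trRe_Mid_rho eps0' (fun P pP h => ref3_gt0 eps1 pP h).
have m1 : (1 <= INR M1)%coqR by apply: (le_INR 1).
have m2 : (1 <= INR M2)%coqR by apply: (le_INR 1).
have m1' := Rlt_le_trans _ _ _ Rlt_0_1 m1; have m2' := Rlt_le_trans _ _ _ Rlt_0_1 m2.
rewrite /IH_X_YZ D1 in HR1; rewrite /IH_Y_XZ D2 in HR2; rewrite /IH_XY_Z D3 in HR12.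
(* The sum-rate constraint becomes a constraint on a single code of size [M1 * M2]. *)
rewrite -log2_mul // in HR12.
have k1 := code_size_bound _ _ _ m1' b1 eps0 HR1.
have k2 := code_size_bound _ _ _ m2' b2 eps0 HR2.
have k3 := code_size_bound _ _ _ (Rmult_lt_0_compat _ _ m1' m2') b3 eps0 HR12.
have bound := error_bound _ _ _ _ _ _ Heps m1 m2 k1 k2 k3; cbv zeta in bound.
have [/RltP del0 /RleP del1] := amplitude_bounds _ Heps.
have /RltP s0 := slack_gt0 _ _ _ Heps m1 m2.
move/ssrnat.leP: (HM1) => M1_gt0; move/ssrnat.leP: (HM2) => M2_gt0.
have hitP P : (trRe N P rho >= 1 - eps)%coqR -> 1 - eps <= \sum_(u < nU) pu u *
    \sum_(x < nX) px u x * \sum_(y < nY) py u y * \tr (test P u x y *m A x y).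
  by move=> h; rewrite -trRe_rho; apply/RleP; apply: Rge_le.
(* The false acceptance bounds passed to [random_mac_code] are the exact values on the reference
   states, so these hypotheses hold by reflexivity. *)
have le1 := lexx (trRe N P1 ref1); rewrite {1}trRe_ref1 in le1.
have le2 := lexx (trRe N P2 ref2); rewrite {1}trRe_ref2 in le2.
have le3 := lexx (trRe N P3 ref3); rewrite {1}trRe_ref3 in le3.
have ge0 : [/\ 0 <= trRe N P1 ref1, 0 <= trRe N P2 ref2 & 0 <= trRe N P3 ref3].
  by split; apply/RleP; apply: Rlt_le.
have [f [g [L [pL sL eL]]]] := random_mac_code (T1 := 'I_M1) (T2 := 'I_M2)
  pu0 px0 py0 pu1 px1 py1 psdA trA
  (fun u x y => effect_test u x y pP1) (fun u x y => effect_test u x y pP2)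
  (fun u x y => effect_test u x y pP3) s0 del0 del1
  (hitP _ h1) (hitP _ h2) (hitP _ h3) le1 le2 le3 ge0
  (Ordinal M1_gt0) (Ordinal M2_gt0).
(* Codewords and measurement operators are extended by [Mzero] beyond the message range, where
   [MAC_code] imposes nothing. *)
pose alpha m : Mat := if insub m is Some i then sX (f i) else Mzero.
pose beta m : Mat := if insub m is Some j then sY (g j) else Mzero.
pose Lam k l : Mat := if (insub k, insub l) is (Some i, Some j) then cx (L i j) else Mzero.
have alphaE (i : 'I_M1) : alpha i = sX (f i) by rewrite /alpha valK.
have betaE (j : 'I_M2) : beta j = sY (g j) by rewrite /beta valK.
have LamE (i : 'I_M1) (j : 'I_M2) : Lam i j = cx (L i j) by rewrite /Lam !valK.
have psdL i j : effect (L i j).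
  split=> //; rewrite -sL (bigD1 i) //= (bigD1 j) //= -[L i j + _ + _]addrA [L i j + _]addrC addrK.
  by apply: psdD; apply: psd_sum => // k _; apply: psd_sum.
exists alpha, beta, Lam; split; [|split; [|split; [|split]]].
- by move=> m /ssrnat.ltP hm; rewrite -[m]/(val (Ordinal hm)) alphaE; apply: HsX.
- by move=> m /ssrnat.ltP hm; rewrite -[m]/(val (Ordinal hm)) betaE; apply: HsY.
- move=> k l /ssrnat.ltP hk /ssrnat.ltP hl.
  by rewrite -[k]/(val (Ordinal hk)) -[l]/(val (Ordinal hl)) LamE; apply: psd_cx.
- apply: rl_inj; rewrite rl_Mid -rl_cx1 -sL.
  (* Completeness is checked on real forms, halved on both sides so that the sum rule for [rlh]
     applies. *)
  apply: (scalerI (a := 2^-1)); first by rewrite invr_eq0 pnatr_eq0.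
  rewrite -!/(rlh _ _) (rlh_csum _ _ (fun k => Msum M2 (Lam k))).
  rewrite [RHS]/rlh rl_cx_sum scaler_sumr; apply: eq_bigr => i _.
  rewrite (rlh_csum _ _ (Lam i)) rl_cx_sum scaler_sumr; apply: eq_bigr => j _.
  by rewrite LamE.
- have -> : rsum M1 (fun k => rsum M2 (fun l =>
      trRe dZ (Msub Mid (Lam k l)) (Phi (kron dX dY (alpha k) (beta l))))) =
      \sum_i \sum_j (1 - \tr (L i j *m A (f i) (g j))).
    rewrite rsumE; apply: eq_bigr => i _; rewrite rsumE; apply: eq_bigr => j _.
    rewrite LamE alphaE betaE -/(W _ _) trRe_rl rl_sub rl_Mid mulmxBl mul1mx.
    have e : \tr (rl dZ (cx (L i j)) *m A (f i) (g j)) = \tr (L i j *m A (f i) (g j)).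
      by rewrite -[LHS]trRe_rl trRe_cx.
    by rewrite linearB /= -/(A (f i) (g j)) trA e.
  move/RleP: eL; rewrite !card_ord -!INRE -RpowE.
  rewrite (INR_IZR_INZ 144) (INR_IZR_INZ 16) (INR_IZR_INZ 4) => eL.
  apply: (Rle_trans _ _ _ _ bound).
  apply: (Rmult_le_reg_l _ _ _ (Rmult_lt_0_compat _ _ m1' m2')).
  rewrite -Rmult_assoc Rinv_r ?Rmult_1_l; first exact: eL.
  exact: Rgt_not_eq (Rmult_lt_0_compat _ _ m1' m2').
Qed.

End Main.
End MacCode.


Theorem theorem1
  (dX dY dZ : nat) (Phi : Mat -> Mat) (HPhi : is_channel (dX * dY) dZ Phi)
  (nU nX nY : nat) (sX sY : nat -> Mat)
  (HsX : forall x, (x < nX)%nat -> density dX (sX x))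
  (HsY : forall y, (y < nY)%nat -> density dY (sY y))
  (pu : nat -> R) (px py : nat -> nat -> R)
  (Hpu0 : forall u, (u < nU)%nat -> 0 <= pu u) (Hpu1 : rsum nU pu = 1)
  (Hpx0 : forall u x, (u < nU)%nat -> (x < nX)%nat -> 0 <= px u x)
  (Hpx1 : forall u, (u < nU)%nat -> rsum nX (px u) = 1)
  (Hpy0 : forall u y, (u < nU)%nat -> (y < nY)%nat -> 0 <= py u y)
  (Hpy1 : forall u, (u < nU)%nat -> rsum nY (py u) = 1)
  (eps : R) (Heps : 0 < eps < 1)
  (M1 M2 : nat) (HM1 : (1 <= M1)%nat) (HM2 : (1 <= M2)%nat)
  (HR1 : log2 (INR M1) <=
           IH_X_YZ nU nX nY dX dY dZ Phi pu px py sX sY eps - 2 - log2 (/ eps))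
  (HR2 : log2 (INR M2) <=
           IH_Y_XZ nU nX nY dX dY dZ Phi pu px py sX sY eps - 2 - log2 (/ eps))
  (HR12 : log2 (INR M1) + log2 (INR M2) <=
           IH_XY_Z nU nX nY dX dY dZ Phi pu px py sX sY eps - 2 - log2 (/ eps)) :
  exists (alpha beta : nat -> Mat) (Lam : nat -> nat -> Mat),
    MAC_code dX dY dZ Phi M1 M2 (2 ^ 135 * Rpower eps (1 / 3)) alpha beta Lam.
Proof. eapply MacCode.mac_code_exists; eassumption. Qed.
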